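(* Let $Y$ be the Banach space with normalized basis $(e_\alpha)_{\alpha\in T}$ (in the lexicographic order) defined in the context. Then: (a) For every sequence $(\lambda_n)_n$ of real numbers with $\lim_n\lambda_n=\infty$ there exists a subsequence $(x_i)$ of $(e_\alpha)$ having a spreading model $(\tilde x_i)$ such that $$\lim_n\frac{\big\|\sum_{i=1}^n\tilde x_i\big\|}{\lambda_n}=0 .$$ (b) For every normalized block basis $(x_i)$ of $(e_\alpha)$ having a spreading model $(\tilde x_i)$, $$\lim_n\Big\|\sum_{i=1}^n\tilde x_i\Big\|=\infty .$$
   Context: Spreading models: a seminormalized sequence $(x_i)$ has the spreading model $(\tilde x_i)$ (a basic sequence in some Banach space) if for some $\varepsilon_n\searrow0$, for all $n$, all $(a_i)_{i=1}^n\in[-1,1]^n$ and all $n\le k_1<\dots<k_n$: $\big|\|\sum_{i=1}^na_ix_{k_i}\|-\|\sum_{i=1}^na_i\tilde x_i\|\big|<\varepsilon_n$. Dyadic tree: $T=\{(n,i): n=0,1,2,\dots,\ 0\le i<2^n\}$, where $(n,i)\prec(m,j)$ iff $n<m$ and $(m,j)$ is a descendant of $(n,i)$, the immediate successors of $(n,i)$ being $(n+1,2i)$ and $(n+1,2i+1)$; $\preceq$ means $\prec$ or equal. A branch is a set $\{(0,0),(1,i_1),(2,i_2),\dots\}$ with $i_k\in\{2i_{k-1},2i_{k-1}+1\}$ for all $k\ge1$ ($i_0=0$); $\mathcal{B}$ is the set of branches. A branch is identified with the $0$-$1$ sequence $(i_k-2i_{k-1})_{k\ge1}$, and then with the finite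 (possibly empty) or infinite sequence $b'=(b'_1,b'_2,\dots)$ of positive integers such that the $1$'s are located exactly at positions $b'_1,\ b'_1+b'_2,\ b'_1+b'_2+b'_3,\dots$ (the empty sequence corresponds to $(0,0,\dots)$). Weights: for each branch $b$ with corresponding $b'$ define $w^{(b)}=(w^{(b)}_n)_{n\ge1}$ as follows. If $b'=\emptyset$, $w^{(b)}_n=1/n$. If $b'\neq\emptyset$, set $w^{(b)}_n=1/b'_1$ for $n=1,\dots,b'_1$. Suppose $w^{(b)}_i$ is defined for $i\le\sigma_n:=b'_1+\dots+b'_n$, with $w^{(b)}_{\sigma_n}=1/K$, $K\in\mathbb{N}$. If $b'=(b'_1,\dots,b'_n)$ has length exactly $n$, set $w^{(b)}_{\sigma_n+j}=1/(K+j)$ for all $j\ge1$. Otherwise, if $b'_{n+1}>K$ set $w^{(b)}_{\sigma_n+j}=1/b'_{n+1}$ for $1\le j\le b'_{n+1}$, and if $b'_{n+1}\le K$ set $w^{(b)}_{\sigma_n+j}=1/(K+j)$ for $1\le j\le b'_{n+1}$. Bushes: let $n\in\mathbb{N}$ and $s_1,\dots,s_n,t_1,\dots,t_n\in T$ with: $s_1\prec\dots\prec s_n$; $s_i\preceq t_i$ for all $i$; $\{t:s_i\preceq t\preceq t_i\}\cap\{t:s_j\preceq t\preceq t_j\}=\emptyset$ for $i\ne j$; and, whenever $s_i\prec t_i$, $\{t:s_i\prec t\preceq t_i\}\cap\{t:s_1\preceq t\preceq s_n\}=\emptyset$. Then $\mathcal{S}=\{t\in T:s_1\preceq t\preceq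 s_n\}\cup\bigcup_{i=1}^n\{t\in T:s_i\preceq t\preceq t_i\}$ (together with the data $s_1,t_1,\dots,s_n,t_n$) is called a bush, denoted $\mathrm{bush}(s_1,t_1,\dots,s_n,t_n)$, and $|\mathcal{S}|:=n$. Bushes are disjoint if the corresponding subsets of $T$ are. Norm: $c_{00}(T)$ is the space of finitely supported real functions on $T$, $e_\alpha(\gamma)=\delta_{\alpha,\gamma}$, and $e^*_\alpha$ are the coordinate functionals. For $k\in\mathbb{N}\cup\{0\}$, a bush $\mathcal{S}=\mathrm{bush}(s_1,t_1,\dots,s_n,t_n)$ and $x\in c_{00}(T)$, $$\|x\|_{k,\mathcal{S}}=\sup\Big\{\sum_{j=1}^nw^{(b)}_{k+j}|e^*_{t_j}(x)|:\ b\in\mathcal{B},\ s_n\in b\Big\}.$$ Define $$\|x\|=\max\Big(\|x\|_\infty,\ \sup\big(\|x\|_{0,\mathcal{S}_1}+\|x\|_{|\mathcal{S}_1|,\mathcal{S}_2}+\dots+\|x\|_{|\mathcal{S}_1|+\dots+|\mathcal{S}_{n-1}|,\mathcal{S}_n}\big)\Big),$$ the supremum being over $n\in\mathbb{N}$ and mutually disjoint bushes $\mathcal{S}_1,\dots,\mathcal{S}_n$. $Y$ is the completion of $(c_{00}(T),\|\cdot\|)$. The basis $(e_\alpha)_{\alpha\in T}$ is taken in the lexicographic order $e_{(0,0)},e_{(1,0)},e_{(1,1)},e_{(2,0)},\dots$. *)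

(* Defs.v *)
From HB Require Import structures.
From Stdlib Require Export Relation_Operators.
From mathcomp Require Export all_boot all_order all_algebra.
From mathcomp Require Export all_classical all_reals all_analysis.

Set Implicit Arguments.
Unset Strict Implicit.
Unset Printing Implicit Defensive.

Export Order.TTheory GRing.Theory Num.Theory.
Export numFieldNormedType.Exports.

Local Open Scope classical_set_scope.

Definition tree := {n : nat & 'I_(2 ^ n)}.
Definition tree_node (n : nat) (i : 'I_(2 ^ n)) : tree := Tagged (fun n => 'I_(2 ^ n)) i.
Arguments tree_node : clear implicits.
Definition tree_level (t : tree) : nat := tag t.
Definition tree_index (t : tree) : nat := tagged t.

Definition tree_root : tree := tree_node 0 (Ordinal (expn_gt0 2 0)).

Definition child (s t : tree) : Prop :=
  tree_level t = (tree_level s).+1 /\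
  (tree_index t = (tree_index s).*2 \/ tree_index t = (tree_index s).*2.+1).

Definition tlt : tree -> tree -> Prop := clos_trans tree child.
Definition tle (s t : tree) : Prop := tlt s t \/ s = t.
Definition tseg (s t : tree) : set tree := [set u | tle s u /\ tle u t].

Definition lex_next (t : tree) : tree :=
  if insub (tree_index t).+1 is Some i then tree_node (tree_level t) i
  else tree_node (tree_level t).+1 (Ordinal (expn_gt0 2 (tree_level t).+1)).
Definition lex (n : nat) : tree := iter n lex_next tree_root.

(** A branch is given by its 0-1 sequence: [b k] is [i_(k+1) - 2 i_k]. *)
Definition branch := nat -> bool.
Fixpoint branch_index (b : branch) (k : nat) : nat :=
  if k is k'.+1 then (branch_index b k').*2 + b k' else 0.
Definition branch_set (b : branch) : set tree :=
  [set t | tree_index t = branch_index b (tree_level t)].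

Variant gaps := FinGaps of seq nat | InfGaps of (nat -> nat).

(** [g] is the sequence b' of [b]; [b k] is the entry at position [k.+1]. *)
Definition gaps_of (b : branch) (g : gaps) : Prop :=
  match g with
  | FinGaps s => all (fun l => 0 < l)%N s /\
      forall k, b k <-> exists2 m, (0 < m <= size s)%N & k.+1 = sumn (take m s)
  | InfGaps f => (forall i, 0 < f i)%N /\
      forall k, b k <-> exists2 m, (0 < m)%N & k.+1 = (\sum_(i < m) f i)%N
  end.

(** Denominator of [w_(sigma + j)], [j >= 1], when [w_sigma = 1 / K] and [s]
    lists the gaps that start at position [sigma].  The initial clauses of the
    definition are the case [sigma = K = 0]: a first gap [l] always exceeds
    [0], and an empty list gives [1 / j]. *)
Fixpoint weight_den (K : nat) (s : seq nat) (j : nat) : nat :=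
  if s is l :: s' then
    if (j <= l)%N then (if (K < l)%N then l else K + j)
    else weight_den (if (K < l)%N then l else K + l) s' (j - l)
  else K + j.

Record bush := Bush {
  bush_pred : nat;
  bush_s : 'I_bush_pred.+1 -> tree;
  bush_t : 'I_bush_pred.+1 -> tree;
  bush_chain : forall i j : 'I_bush_pred.+1, (i < j)%N -> tlt (bush_s i) (bush_s j);
  bush_le : forall i, tle (bush_s i) (bush_t i);
  bush_disj : forall i j, i != j ->
    tseg (bush_s i) (bush_t i) `&` tseg (bush_s j) (bush_t j) = set0;
  bush_trunk : forall i, tlt (bush_s i) (bush_t i) ->
    [set u | tlt (bush_s i) u /\ tle u (bush_t i)]
      `&` tseg (bush_s ord0) (bush_s ord_max) = set0
}.

Arguments bush_s : clear implicits.
Arguments bush_t : clear implicits.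

Definition bush_card (S : bush) : nat := (bush_pred S).+1.
Definition bush_set (S : bush) : set tree :=
  tseg (bush_s S ord0) (bush_s S ord_max)
  `|` \bigcup_i tseg (bush_s S i) (bush_t S i).

Local Open Scope ring_scope.

(** For an infinite sequence of positive gaps, the first [n] gaps cover the
    positions [1, ..., n]. *)
Definition weight (R : realType) (g : gaps) (n : nat) : R :=
  (weight_den 0 (match g with FinGaps s => s | InfGaps f => mkseq f n end) n)%:R^-1.

Section TreeSpace.
Variable R : realType.

Definition fin_supp : {pred tree -> R} :=
  [pred x : tree -> R | `[< finite_set [set t | x t != 0] >]].

Lemma fin_supp_submod_closed : submod_closed fin_supp.
Proof.
split; first by apply/asboolP; apply: sub_finite_set (@finite_set0 tree) => t /=; rewrite eqxx.
move=> a x y /asboolP fx /asboolP fy; apply/asboolP.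
have fxy : finite_set ([set t | x t != 0] `|` [set t | y t != 0]).
  by rewrite finite_setU.
apply: (sub_finite_set _ fxy) => t /= h.
have [x0|] := eqVneq (x t) 0; last by left.
right; apply: contra_neq h => y0.
by rewrite -[LHS]/(a * x t + y t) x0 y0 mulr0 addr0.
Qed.

HB.instance Definition _ :=
  GRing.isSubmodClosed.Build R (tree -> R) fin_supp fin_supp_submod_closed.

Record c00 := C00 { c00_val :> tree -> R; c00P : c00_val \in fin_supp }.
HB.instance Definition _ := [isSub for c00_val].
HB.instance Definition _ := [Choice of c00 by <:].
HB.instance Definition _ := [SubChoice_isSubLmodule of c00 by <:].

Lemma unit_vec_subproof (t : tree) : (fun u => (u == t)%:R : R) \in fin_supp.
Proof.
apply/asboolP; apply: (sub_finite_set _ (finite_set1 t)) => u /=.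
by have [//|_] := eqVneq u t; rewrite eqxx.
Qed.
Definition unit_vec (t : tree) : c00 := C00 (unit_vec_subproof t).

Definition bush_norm (k : nat) (S : bush) (x : c00) : R :=
  sup [set r | exists b g, [/\ gaps_of b g, branch_set b (bush_s S ord_max) &
    r = \sum_(j < bush_card S) weight R g (k + j.+1)%N * `|x (bush_t S j)|]].

Definition tree_norm (x : c00) : R :=
  Num.max (sup (range (fun t => `|x t|)))
    (sup [set r | exists n (S : 'I_n.+1 -> bush),
      (forall i j, i != j -> bush_set (S i) `&` bush_set (S j) = set0) /\
      r = \sum_(i < n.+1) bush_norm (\sum_(j < n.+1 | j < i) bush_card (S j))%N (S i) x]).

End TreeSpace.

(** Sequences [(x_i)_(i >= 1)] are functions on [nat] with [x_i] at index
    [i - 1]. *)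

Section BanachSequences.
Variable R : realType.

Definition lin_span (E : normedModType R) (x : nat -> E) : set E :=
  [set y | exists n (a : nat -> R), y = \sum_(i < n) a i *: x i].

(** [x] is a Schauder basis of its closed linear span. *)
Definition basic_sequence (E : completeNormedModType R) (x : nat -> E) : Prop :=
  forall y, closure (lin_span x) y ->
    exists! a : nat -> R, series (fun i => a i *: x i) @ \oo --> y.

Definition seminormalized (E : normedModType R) (x : nat -> E) : Prop :=
  exists c C : R, 0 < c /\ forall i, c <= `|x i| <= C.

(** [k i] is the 0-based version of [k_(i+1)], so that [n <= k_1 < ... < k_n]
    becomes [n <= (k i).+1] together with strict monotonicity of [k]. *)
Definition has_spreading_model (E : normedModType R) (x : nat -> E)
    (F : completeNormedModType R) (xt : nat -> F) : Prop :=
  [/\ seminormalized x, basic_sequence xt &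
    exists eps : nat -> R,
      [/\ nonincreasing_seq eps, eps @ \oo --> (0 : R) &
        forall n, (0 < n)%N ->
        forall a : 'I_n -> R, (forall i, -1 <= a i <= 1) ->
        forall k : 'I_n -> nat, {homo k : i j / (i < j)%N} ->
          (forall i, (n <= (k i).+1)%N) ->
        `| `|\sum_(i < n) a i *: x (k i)| - `|\sum_(i < n) a i *: xt i| |
          < eps n]].

Definition subsequence_of (A : Type) (x e : nat -> A) : Prop :=
  exists phi : nat -> nat, {homo phi : i j / (i < j)%N} /\ x = e \o phi.

Definition block_basis (E : normedModType R) (e x : nat -> E) : Prop :=
  exists (p : nat -> nat) (a : nat -> R), {homo p : i j / (i < j)%N} /\
    forall i, x i = \sum_(p i <= j < p i.+1) a j *: e j /\ x i != 0.

Definition is_completion (V : lmodType R) (N : V -> R)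
    (Y : completeNormedModType R) (iota : {linear V -> Y}) : Prop :=
  (forall x, `|iota x| = N x) /\ dense (range iota).

End BanachSequences.

(* Main.v *)
Require Import Defs.
From HB Require Import structures.
From mathcomp Require Import zify ring lra.

(** The norm is first rewritten as a supremum over families, that is, lists of
    disjoint bushes together with a choice of one branch for each bush
    ([tree_norm_le], [family_value_le_tree_norm]).  Terms may be dropped from a
    family: the remaining ones still form bushes, and they move to earlier
    positions, where the weights are not smaller ([wsum_filter]).

    Small spreading models.  Each gap of a branch contributes at most [1] to the
    sum of its weights, so for a branch with very long gaps this sum grows more
    slowly than [lambda].  The subsequence consists of the nodes of such a branch
    at the ends of its gaps.  Consider a combination of [n] such nodes that lie
    beyond the first [n] gaps.  A bush that reaches one of them from a starting
    point beyond these gaps must use the first [n] weights of the given branch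
    ([weight_agree]).  A bush that reaches one of them from a lower starting
    point may use any branch, but by disjointness there is at most one such
    bush; it can do this for one node only, and it blocks all the earlier ones.
    So the norm is a maximum over configurations that only involve the
    coefficients ([family_value_le_config], [config_le_tree_norm]).  Hence it
    does not depend on the chosen nodes ([tree_norm_spread]), and for
    coefficients [1] it is at most [1] plus the sum of the first [n] weights
    ([tree_norm_sum_le]).  The spreading model is realized by truncated shifts of
    the sequence inside the space of bounded sequences of vectors
    ([spread_seq_spreading_model]).  It is basic because its partial sums have
    increasing norms ([monotone_basic_sequence]).

    Block bases.  If infinitely many blocks have a coefficient of modulus at
    least [delta], then by compactness nodes with such coefficients can be
    chosen so that they leave one branch at increasing levels.  They form one
    bush, and the norm of a sum of [n] of the blocks is at least [delta] times the
    sum of [n] weights of that branch ([large_blocks]), which is unbounded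
    because the weights of no branch are summable ([sum_weight_dvg]).  If the
    coefficients tend to [0], then a family that nearly attains the norm [1] of a
    late block loses little when it gives up its first [K] terms and all terms
    that start at low levels ([small_family]).  The rest can be appended to a
    family with [K] terms that was built for the blocks chosen before, and the
    terms keep at least their weights.  So the sum of [n] suitable blocks has
    norm at least [n / 2] ([small_blocks]).  In both cases the blocks can be
    chosen arbitrarily late, so the norms pass to any spreading model. *)

Set Implicit Arguments.
Unset Strict Implicit.
Unset Printing Implicit Defensive.

Local Open Scope classical_set_scope.

(** * The tree order *)

Lemma tree_eq (s t : tree) :
  tree_level s = tree_level t -> tree_index s = tree_index t -> s = t.
Proof.
case: s t => [m i] [n j]; rewrite /tree_level /tree_index /= => mn.
by case: n / mn j => j ij; congr existT; apply: val_inj.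
Qed.

Lemma tree_index_lt (t : tree) : tree_index t < 2 ^ tree_level t.
Proof. by rewrite /tree_index; exact: ltn_ord. Qed.

Definition tleb (s t : tree) : bool :=
  (tree_level s <= tree_level t) &&
  (tree_index t %/ 2 ^ (tree_level t - tree_level s) == tree_index s).

Definition tltb (s t : tree) : bool :=
  tleb s t && (tree_level s < tree_level t).

Lemma tleb_refl : reflexive tleb.
Proof. by move=> t; rewrite /tleb leqnn subnn divn1 eqxx. Qed.

Lemma tleb_trans : transitive tleb.
Proof.
move=> t s u /andP[st /eqP ts] /andP[tu /eqP ut]; rewrite /tleb (leq_trans st tu) /=.
rewrite -ts -ut -divnMA -expnD; apply/eqP; congr (_ %/ 2 ^ _); lia.
Qed.

Lemma tleb_level (s t : tree) : tleb s t -> tree_level s <= tree_level t.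
Proof. by case/andP. Qed.

Lemma tleb_eq (s t : tree) : tleb s t -> tree_level s = tree_level t -> s = t.
Proof.
move=> /andP[_ /eqP e] st; apply: tree_eq => //.
by rewrite -e st subnn divn1.
Qed.

Lemma tlebNlt (s t : tree) : tleb s t -> s = t \/ tltb s t.
Proof.
move=> st; have := tleb_level st; rewrite leq_eqVlt => /orP[/eqP e|lt].
  by left; exact: tleb_eq.
by right; rewrite /tltb st.
Qed.

Lemma tltb_le (s t : tree) : tltb s t -> tleb s t.
Proof. by case/andP. Qed.

Lemma tltb_level (s t : tree) : tltb s t -> tree_level s < tree_level t.
Proof. by case/andP. Qed.

Lemma tleb_chain (s t u : tree) : tleb s u -> tleb t u ->
  tree_level s <= tree_level t -> tleb s t.
Proof.
move=> /andP[su /eqP us] /andP[tu /eqP ut] st; rewrite /tleb st /= -us -ut.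
rewrite -divnMA -expnD; apply/eqP; congr (_ %/ 2 ^ _); lia.
Qed.

Lemma tleb_root (t : tree) : tleb tree_root t.
Proof.
by rewrite /tleb /= subn0 divn_small ?eqxx //; exact: tree_index_lt.
Qed.

Lemma childP (s t : tree) :
  child s t <-> tree_level t = (tree_level s).+1 /\ tleb s t.
Proof.
split=> [[ls h]|[ls /andP[_]]].
  split=> //; rewrite /tleb ls leqnSn subSnn expn1 divn2 /=; apply/eqP.
  by case: h => ->; rewrite ?uphalf_double ?doubleK; lia.
rewrite ls subSnn expn1 divn2 => /eqP e; split=> //.
have := odd_double_half (tree_index t); rewrite e.
by case: odd => /= <-; [right|left].
Qed.

Lemma parent_exists (n : nat) (t : tree) : tree_level t = n.+1 ->
  exists p, [/\ tree_level p = n, tree_index p = (tree_index t)./2 & tleb p t].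
Proof.
move=> lt; have it : (tree_index t)./2 < 2 ^ n.
  have := tree_index_lt t; rewrite lt expnS; lia.
exists (tree_node n (Ordinal it)); split=> //.
by rewrite /tleb lt leqnSn subSnn expn1 divn2 eqxx.
Qed.

Lemma tltP (s t : tree) : tlt s t <-> tltb s t.
Proof.
split.
  elim=> {s t} [s t /childP[ls st]|s t u _ st _ tu].
    by rewrite /tltb st ls /=.
  rewrite /tltb (tleb_trans (tltb_le st) (tltb_le tu)) /=.
  exact: ltn_trans (tltb_level st) (tltb_level tu).
case/andP; move: t; suff H n t : tree_level t = n -> tleb s t ->
    tree_level s < tree_level t -> tlt s t by move=> t; exact: H.
elim: n t => [t -> //|n IHn t lt st slt].
have [p [lp _ pt]] := parent_exists lt.
have cpt : child p t by apply/childP; rewrite lp.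
have sp : tleb s p by apply: tleb_chain st pt _; rewrite lp -ltnS -lt.
case: (tlebNlt sp) => [->|/andP[_ lsp]]; first exact: t_step.
exact: t_trans (IHn _ lp sp lsp) (t_step _ _ _ _ cpt).
Qed.

Lemma tleP (s t : tree) : tle s t <-> tleb s t.
Proof.
split=> [[/tltP/tltb_le //|->]|/tlebNlt[->|/tltP]]; [exact: tleb_refl|by right|by left].
Qed.

(** * The lexicographic enumeration *)

(** The levels before that of [t] contain [2 ^ tree_level t - 1] nodes. *)
Definition lex_rank (t : tree) : nat := (2 ^ tree_level t).-1 + tree_index t.

Lemma lex_rank_next (t : tree) : lex_rank (lex_next t) = (lex_rank t).+1.
Proof.
rewrite /lex_next /lex_rank; case: insubP => [i lti ei|] /=.
  rewrite /tree_level /tree_index /= in lti ei *.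
  by rewrite ei addnS.
rewrite -leqNgt => h; have e : (tree_index t).+1 = 2 ^ tree_level t.
  by apply/eqP; rewrite eqn_leq h tree_index_lt.
have -> : tree_index (tree_node _ (Ordinal (expn_gt0 2 (tree_level t).+1))) = 0 by [].
by rewrite expnS -e; lia.
Qed.

Lemma lex_rankK (n : nat) : lex_rank (lex n) = n.
Proof. by elim: n => // n IHn; rewrite /lex iterS lex_rank_next -/(lex n) IHn. Qed.

Lemma lex_rank_lt (s t : tree) :
  tree_level s < tree_level t -> lex_rank s < lex_rank t.
Proof.
move=> st; rewrite /lex_rank.
have := tree_index_lt s; have : 2 ^ (tree_level s).+1 <= 2 ^ tree_level t by rewrite leq_exp2l.
rewrite expnS; have := expn_gt0 2 (tree_level s); lia.
Qed.

Lemma lex_rank_inj : injective lex_rank.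
Proof.
move=> s t e; have est : tree_level s = tree_level t.
  by case: (ltngtP (tree_level s) (tree_level t)) => // /lex_rank_lt; rewrite e ltnn.
by apply: tree_eq => //; move: e; rewrite /lex_rank est; apply: addnI.
Qed.

Lemma lex_rankE (t : tree) : lex (lex_rank t) = t.
Proof. by apply: lex_rank_inj; rewrite lex_rankK. Qed.

Lemma lex_rank_ub (t : tree) (n : nat) : tree_level t <= n -> lex_rank t < 2 ^ n.+1.
Proof.
move=> tn; rewrite /lex_rank.
have := tree_index_lt t; have : 2 ^ (tree_level t) <= 2 ^ n by rewrite leq_exp2l.
rewrite expnS; have := expn_gt0 2 (tree_level t); lia.
Qed.

Lemma level_lex_rank (t : tree) : tree_level t <= lex_rank t.
Proof.
rewrite /lex_rank; have : tree_level t < 2 ^ tree_level t by exact: ltn_expl.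
lia.
Qed.

(** * Branches *)

Lemma branch_index_lt (b : branch) (n : nat) : branch_index b n < 2 ^ n.
Proof. by elim: n => //= n IHn; rewrite expnS; case: (b n); lia. Qed.

Definition bnode (b : branch) (n : nat) : tree :=
  tree_node n (Ordinal (branch_index_lt b n)).

Lemma bnode_level b n : tree_level (bnode b n) = n. Proof. by []. Qed.
Lemma bnode_index b n : tree_index (bnode b n) = branch_index b n. Proof. by []. Qed.

Lemma branch_setE b t : branch_set b t -> t = bnode b (tree_level t).
Proof. by move=> h; apply: tree_eq. Qed.

Lemma branch_index_div b m n : m <= n ->
  branch_index b n %/ 2 ^ (n - m) = branch_index b m.
Proof.
elim: n => [|n IHn]; first by rewrite leqn0 => /eqP ->; rewrite divn1.
rewrite leq_eqVlt => /orP[/eqP ->|]; first by rewrite subnn divn1.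
rewrite ltnS => mn; rewrite subSn // expnS divnMA -(IHn mn) /=.
by congr (_ %/ _); rewrite divn2; case: (b n); rewrite ?addn1 ?addn0 /= ?uphalf_double ?doubleK.
Qed.

Lemma bnode_le b m n : m <= n -> tleb (bnode b m) (bnode b n).
Proof. by move=> mn; rewrite /tleb !bnode_level !bnode_index mn branch_index_div /=. Qed.

Lemma branch_set_le b s t : tleb s t -> branch_set b t -> branch_set b s.
Proof.
move=> st bt; have nt := bnode_le b (tleb_level st); rewrite -(branch_setE bt) in nt.
by rewrite (@tleb_eq s (bnode b (tree_level s))) //; apply: tleb_chain st nt _.
Qed.

Lemma bnode_eqP b b' n :
  bnode b n = bnode b' n <-> forall k, k < n -> b k = b' k.
Proof.
split=> [e k kn|e].
  have /(congr1 tree_index) : bnode b k.+1 = bnode b' k.+1.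
    apply: (@tleb_eq) => //; apply: (@tleb_chain _ _ (bnode b n)) => //; first exact: bnode_le.
    by rewrite e; exact: bnode_le.
  have ek : branch_index b k = branch_index b' k.
    rewrite -(@branch_index_div b k n) ?(ltnW kn)// -(@branch_index_div b' k n) ?(ltnW kn)//.
    by have /(congr1 tree_index) := e; rewrite !bnode_index => ->.
  by rewrite !bnode_index /= ek => /addnI; case: (b k); case: (b' k).
apply: tree_eq => //; rewrite !bnode_index; elim: n e => //= n IHn e.
by rewrite (e n) // IHn // => k kn; apply: e; exact: ltnW.
Qed.

Lemma branch_exists (t : tree) : exists b, branch_set b t.
Proof.
suff H n t' : tree_level t' = n -> exists b, branch_set b t' by exact: H.
elim: n t' => [|n IHn] {}t lt.
  exists xpred0; rewrite /branch_set /= lt.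
  by have := tree_index_lt t; rewrite lt expn0 /=; case: tree_index.
have [p [lp ip _]] := parent_exists lt.
have [b /branch_setE pb] := IHn p lp; rewrite lp in pb.
exists (fun k => if k < n then b k else odd (tree_index t)).
rewrite /branch_set /= lt /= ltnn.
set b' := fun _ => _.
have : bnode b' n = bnode b n by apply/bnode_eqP => k kn; rewrite /b' kn.
rewrite -pb => /(congr1 tree_index); rewrite bnode_index => ->; rewrite ip.
by rewrite [LHS](esym (odd_double_half _)) addnC.
Qed.

(** * Gap sequences *)

Definition gaps_prefix (g : gaps) (i : nat) : seq nat :=
  match g with FinGaps s => take i s | InfGaps f => mkseq f i end.

Definition gaps_pos (g : gaps) : Prop :=
  match g with FinGaps s => all (ltn 0) s | InfGaps f => forall i, 0 < f i end.

Lemma gaps_of_pos b g : gaps_of b g -> gaps_pos g.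
Proof. by case: g => [s|f] []. Qed.

Lemma gaps_prefix_pos g i : gaps_pos g -> all (ltn 0) (gaps_prefix g i).
Proof.
case: g => [s|f] /= h; first by rewrite -(cat_take_drop i s) all_cat in h; case/andP: h.
by apply/allP => _ /mapP[j _ ->]; exact: h.
Qed.

Lemma take_gaps_prefix g i j : i <= j -> take i (gaps_prefix g j) = gaps_prefix g i.
Proof.
case: g => [s|f] ij /=; first by rewrite take_takel.
by rewrite /mkseq -map_take take_iota; congr map; congr iota; lia.
Qed.

Lemma gaps_prefix_cat g i j : i <= j ->
  gaps_prefix g j = gaps_prefix g i ++ drop i (gaps_prefix g j).
Proof. by move=> ij; rewrite -[LHS](cat_take_drop i) take_gaps_prefix. Qed.

Lemma sumn_gaps_prefix_le g i j : i <= j ->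
  sumn (gaps_prefix g i) <= sumn (gaps_prefix g j).
Proof. by move=> ij; rewrite (gaps_prefix_cat g ij) sumn_cat leq_addr. Qed.

Lemma gaps_prefix_rcons g i m : i < m -> size (gaps_prefix g m) = m ->
  size (gaps_prefix g i.+1) = i.+1 /\
  exists2 x, gaps_prefix g i.+1 = rcons (gaps_prefix g i) x &
             (gaps_pos g -> 0 < x).
Proof.
move=> im sm; rewrite -(take_gaps_prefix g im); split; first by rewrite size_takel ?sm.
exists (nth 0 (gaps_prefix g m) i); first by rewrite (take_nth 0) ?sm// take_gaps_prefix // ltnW.
by move=> /(gaps_prefix_pos m) /(all_nthP 0); apply; rewrite sm.
Qed.

Lemma sumn_mkseq (f : nat -> nat) m : sumn (mkseq f m) = (\sum_(i < m) f i)%N.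
Proof. by rewrite sumnE big_map -{1}(subn0 m) -/(index_iota 0 m) big_mkord. Qed.

Lemma gaps_ofE b g k : gaps_of b g ->
  b k <-> exists m, [/\ 0 < m, size (gaps_prefix g m) = m
                      & k.+1 = sumn (gaps_prefix g m)].
Proof.
case: g => [s|f] [_ ->]; split=> /=.
- by move=> [m /andP[m0 ms] e]; exists m; rewrite size_takel.
- move=> [m [m0 ms e]]; exists m; rewrite // m0 -ms size_take /=; case: ltnP => //; exact: ltnW.
- move=> [m m0 e]; exists m; rewrite size_mkseq; split=> //.
  by rewrite e sumn_mkseq.
- move=> [m [m0 _ e]]; exists m => //.
  by rewrite e sumn_mkseq.
Qed.

(** Once the first gaps agree, the end of the next gap of either sequence is
    the position of a [1] in both branches, so neither of the two next gaps
    exceeds the other. *)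
Lemma gaps_prefix_agree b g b' g' m L : gaps_of b g -> gaps_of b' g' ->
  (forall k, k < L -> b k = b' k) ->
  size (gaps_prefix g m) = m -> sumn (gaps_prefix g m) <= L ->
  gaps_prefix g' m = gaps_prefix g m.
Proof.
move=> gb gb' bb' sm smL; suff H i : i <= m -> gaps_prefix g' i = gaps_prefix g i by exact: H.
elim: i => [|i IHi] im; first by rewrite -!(take_gaps_prefix _ (leq0n m)) !take0.
have {}IHi := IHi (ltnW im).
have [si [x ex x0]] := gaps_prefix_rcons im sm.
have {}x0 := x0 (gaps_of_pos gb).
have sxL : sumn (gaps_prefix g i) + x <= L.
  apply: leq_trans smL; have := sumn_gaps_prefix_le g im.
  by rewrite ex sumn_rcons.
set sg := sumn (gaps_prefix g i) in sxL.
have eS a : a > 0 -> (sg + a).-1.+1 = sg + a by lia.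
have : b' (sg + x).-1.
  rewrite -bb'; last by lia.
  by apply/(gaps_ofE _ gb); exists i.+1; rewrite si ex sumn_rcons -/sg eS.
move=> /(gaps_ofE _ gb') [m' [m'0 sm' em']].
have im' : i < m'.
  rewrite ltnNge; apply/negP => /(sumn_gaps_prefix_le g').
  by rewrite -em' IHi -/sg; lia.
have [si' [y ey y0]] := gaps_prefix_rcons im' sm'.
have {}y0 := y0 (gaps_of_pos gb').
have yx : y <= x.
  by have := sumn_gaps_prefix_le g' im'; rewrite ey sumn_rcons IHi -em' -/sg; lia.
have : b (sg + y).-1.
  rewrite bb'; last by lia.
  by apply/(gaps_ofE _ gb'); exists i.+1; rewrite si' ey sumn_rcons IHi -/sg eS.
move=> /(gaps_ofE _ gb) [m'' [m''0 sm'' em'']].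
have im'' : i < m''.
  rewrite ltnNge; apply/negP => /(sumn_gaps_prefix_le g).
  by rewrite -em'' -/sg; lia.
have xy : x <= y.
  by have := sumn_gaps_prefix_le g im''; rewrite ex sumn_rcons -em'' -/sg; lia.
rewrite ex ey IHi; congr rcons; lia.
Qed.

(** If the branch has finitely many ones, the gaps are collected by induction on
    a bound of their positions.  Otherwise [e i] is the position of the [i]-th
    one, and the gaps are the differences of consecutive positions. *)
Lemma gaps_exist (b : branch) : exists g, gaps_of b g.
Proof.
have [[N bN]|inf] := pselect (exists N, forall k, N <= k -> b k = false).
  have [s [s0 sN h]] : exists s, [/\ all (ltn 0) s, sumn s <= N &
      forall k, k < N -> b k <-> exists2 m, 0 < m <= size s & k.+1 = sumn (take m s)].
    elim: N {bN} => [|N [s [s0 sN h]]]; first by exists [::].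
    case bN : (b N).
      have eN : sumn s + (N.+1 - sumn s) = N.+1 by lia.
      exists (rcons s (N.+1 - sumn s)); have N0 : ltn 0 (N.+1 - sumn s) by rewrite /= subn_gt0 ltnS.
      rewrite all_rcons N0 s0 sumn_rcons eN.
      split=> // k; rewrite ltnS leq_eqVlt size_rcons => /orP[/eqP ->|kN].
        rewrite bN; split=> // _; exists (size s).+1; rewrite ?leqnn //.
        by rewrite take_oversize ?size_rcons // sumn_rcons eN.
      rewrite h //; split=> -[m mS e]; exists m.
      - lia.
      - by rewrite e -cats1 takel_cat //; lia.
      - case: (ltnP (size s) m) => [sm|]; last by lia.
        by move: e; rewrite take_oversize ?size_rcons // sumn_rcons eN; lia.
      - case: (ltnP (size s) m) => [sm|ms].
          by move: e; rewrite take_oversize ?size_rcons // sumn_rcons eN; lia.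
        by rewrite e -cats1 takel_cat.
    exists s; split=> //; first by lia.
    move=> k; rewrite ltnS leq_eqVlt => /orP[/eqP ->|]; last exact: h.
    rewrite bN; split=> // -[m _ e]; move: sN.
    by rewrite -(cat_take_drop m s) sumn_cat -e; lia.
  exists (FinGaps s); split=> // k; case: (ltnP k N) => [|Nk]; first exact: h.
  rewrite bN //; split=> // -[m _ e]; move: sN.
  by rewrite -(cat_take_drop m s) sumn_cat -e; lia.
have H N : exists k, (N <= k) && b k.
  apply: contrapT => h; apply: inf; exists N => k Nk.
  by apply/negP => bk; apply: h; exists k; rewrite Nk.
pose nxt N := ex_minn (H N).
have nxtP N : [/\ N <= nxt N, b (nxt N) & forall k, N <= k -> b k -> nxt N <= k].
  rewrite /nxt; case: ex_minnP => k /andP[Nk bk] mk; split=> // j Nj bj.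
  by apply: mk; rewrite Nj.
pose e := fix e i := if i is i'.+1 then nxt (e i').+1 else nxt 0.
pose f i := if i is i'.+1 then e i - e i' else (e 0).+1.
have eS i : e i < e i.+1 by have [] := nxtP (e i).+1.
have be i : b (e i) by case: i => [|i]; [case: (nxtP 0) | case: (nxtP (e i).+1)].
have sf m : (\sum_(i < m.+1) f i = (e m).+1)%N.
  elim: m => [|m IHm]; first by rewrite big_ord_recr big_ord0.
  rewrite big_ord_recr IHm; have -> : f (@ord_max m.+1) = e m.+1 - e m by [].
  by rewrite [LHS]addSn subnKC // ltnW.
exists (InfGaps f); split=> [[|i] //|k]; first by rewrite subn_gt0; exact: eS.
split=> [bk|[[//|m] _]]; last by rewrite sf => -[->].
have ie i : i <= e i by elim: i => // i IHi; exact: leq_ltn_trans IHi (eS i).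
have [|m km mm] := ex_minnP (P := fun m => k <= e m) _; first by exists k.
exists m.+1 => //; rewrite sf; congr _.+1; apply/eqP; rewrite eqn_leq km /=.
case: m km mm => [|m] km mm.
  by have [_ _ ->] := nxtP 0.
have [_ _ ->] // := nxtP (e m).+1; rewrite ltnNge; apply/negP => /mm.
by rewrite ltnn.
Qed.

(** * The weights *)

Lemma weight_den_cat K s s' j : 0 < j <= sumn s ->
  weight_den K (s ++ s') j = weight_den K s j.
Proof.
elim: s K j => [|l s IHs] K j /= h; first by lia.
by case: ifP => // jl; apply: IHs; lia.
Qed.

Lemma weight_den_gt K s j : 0 < j -> K < weight_den K s j.
Proof.
elim: s K j => [|l s IHs] K j /= j0; first by lia.
case: ifP => jl; first by case: ifP; lia.
by apply: leq_ltn_trans (IHs _ _ _); [case: ifP; lia|lia].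
Qed.

Lemma weight_den_le K s j j' : 0 < j <= j' ->
  weight_den K s j <= weight_den K s j'.
Proof.
elim: s K j j' => [|l s IHs] K j j' /= h; first by lia.
case: (leqP j' l) => j'l; first by rewrite (_ : j <= l); [case: ifP; lia|lia].
case: ifP => jl; last by apply: IHs; lia.
apply: leq_trans (ltnW (weight_den_gt _ _ _)); last by lia.
case: ifP; lia.
Qed.

(** A denominator that skips a value can only be the length [l] of a gap that
    starts at this position, and it then persists for [l] positions. *)
Lemma weight_den_jump K s j t : all (ltn 0) s -> 0 < j ->
  (weight_den K s j).+1 < weight_den K s j.+1 ->
  0 < t <= weight_den K s j.+1 ->
  weight_den K s (j + t) = weight_den K s j.+1.
Proof.
elim: s K j => [|l s IHs] K j /=; first by lia.
move=> /andP[l0 s0] j0; case: (ltnP j l) => jl.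
  by rewrite (ltnW jl); case: ifP; lia.
case: (ltnP l j) => lj.
  rewrite (subSn jl) => h1 h2; rewrite ifN -?ltnNge; last by lia.
  by rewrite -addnBAC //; apply: IHs => //; lia.
have {jl lj} -> : j = l by lia.
rewrite subSnn addKn; move: (if K < l then l else K + l) => K2 h1 h2.
rewrite ifN -?ltnNge; last by lia.
case: s s0 h1 h2 {IHs} => [|l' s] /=; first by lia.
move=> /andP[l'0 _]; rewrite l'0; case: ifP => K2l h1 h2; last by lia.
by rewrite ifT //; case/andP: h2.
Qed.

Section Weights.
Variable R : realType.
Implicit Types g : gaps.
Local Open Scope ring_scope.

Definition wden g (n : nat) : nat :=
  weight_den 0 (match g with FinGaps s => s | InfGaps f => mkseq f n end) n.

Lemma weightE g n : weight R g n = (wden g n)%:R^-1.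
Proof. by []. Qed.

Lemma weight_ge0 g n : 0 <= weight R g n.
Proof. by rewrite weightE invr_ge0. Qed.

Lemma weight_le1 g n : weight R g n <= 1.
Proof.
rewrite weightE; case: (wden g n) => [|d]; first by rewrite invr0.
by rewrite invf_le1 // ler1n.
Qed.

Lemma size_le_sumn (s : seq nat) : all (ltn 0) s -> (size s <= sumn s)%N.
Proof. by elim: s => //= l s IHs /andP[l0 /IHs]; lia. Qed.

(** The list of gaps from which a weight is computed grows with its position;
    a common list for all positions up to [N] makes the lemmas on
    [weight_den] available. *)
Lemma wden_common g N : gaps_pos g -> exists2 s, all (ltn 0) s &
  forall n, (0 < n <= N)%N -> wden g n = weight_den 0 s n.
Proof.
case: g => [s|f] g0; first by exists s.
have g0' n := gaps_prefix_pos n (g0 : gaps_pos (InfGaps f)).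
exists (mkseq f N) => [|n nN]; first exact: g0' N.
rewrite -[mkseq f N]/(gaps_prefix (InfGaps f) N) (@gaps_prefix_cat _ n); last by lia.
rewrite weight_den_cat //= (andP nN).1 /=.
by apply: leq_trans (size_le_sumn (g0' n)); rewrite size_mkseq.
Qed.

Lemma wden_prefix g n m : gaps_pos g -> (0 < n <= sumn (gaps_prefix g m))%N ->
  wden g n = weight_den 0 (gaps_prefix g m) n.
Proof.
case: g => [s|f] g0 h; first by rewrite -(weight_den_cat _ (drop m s)) // cat_take_drop.
have [nm|mn] := leqP n m; rewrite /wden.
  rewrite (gaps_prefix_cat _ nm) weight_den_cat //= (andP h).1 /=.
  by apply: leq_trans (size_le_sumn (gaps_prefix_pos n g0)); rewrite size_mkseq.
rewrite -[mkseq f n]/(gaps_prefix (InfGaps f) n) (gaps_prefix_cat _ (ltnW mn)).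
by rewrite weight_den_cat.
Qed.

Lemma wden_gt0 g n : gaps_pos g -> (0 < n)%N -> (0 < wden g n)%N.
Proof. by move=> g0 n0; exact: weight_den_gt. Qed.

Lemma wden_le g m n : gaps_pos g -> (0 < m <= n)%N -> (wden g m <= wden g n)%N.
Proof.
move=> g0 mn; have [s _ h] := wden_common n g0.
by rewrite !h; [exact: weight_den_le|lia|lia].
Qed.

Lemma weight_le g m n : gaps_pos g -> (0 < m <= n)%N ->
  weight R g n <= weight R g m.
Proof.
move=> g0 mn; rewrite !weightE lef_pV2 ?posrE ?ltr0n ?ler_nat ?wden_gt0 ?wden_le //; lia.
Qed.

Lemma wden_jump g j t : gaps_pos g -> (0 < j)%N ->
  ((wden g j).+1 < wden g j.+1)%N -> (0 < t <= wden g j.+1)%N ->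
  wden g (j + t) = wden g j.+1.
Proof.
move=> g0 j0 jj tj; have [s s0 h] := wden_common (j + t).+1 g0.
move: jj tj; rewrite !h; try lia; exact: weight_den_jump.
Qed.

(** A branch determines the first [n] weights as soon as it is known up to the
    end of a gap that covers the position [n].  A shorter part of the branch
    does not suffice, since the length of an unfinished gap affects the weights
    inside it. *)
Lemma weight_agree b g b' g' m n L : gaps_of b g -> gaps_of b' g' ->
  (forall k, (k < L)%N -> b k = b' k) ->
  size (gaps_prefix g m) = m -> (sumn (gaps_prefix g m) <= L)%N ->
  (0 < n <= sumn (gaps_prefix g m))%N -> weight R g' n = weight R g n.
Proof.
move=> gb gb' bb' sm sL nm; have e := gaps_prefix_agree gb gb' bb' sm sL.
rewrite !weightE (wden_prefix (gaps_of_pos gb) nm).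
by rewrite (@wden_prefix g' n m) ?e//; exact: gaps_of_pos gb'.
Qed.

(** A gap [l] covers [l] positions with denominators at least [l], so that it
    contributes at most [1]. *)
Lemma sum_weight_den_le K s n : all (ltn 0) s -> (n <= sumn s)%N ->
  \sum_(q < n) (weight_den K s q.+1)%:R^-1 <= (size s)%:R :> R.
Proof.
elim: s K n => [|l s IHs] K n /=.
  by rewrite leqn0 => _ /eqP ->; rewrite big_ord0.
move=> /andP[l0 s0] nl.
have H m : (m <= l)%N ->
    \sum_(q < m) (weight_den K (l :: s) q.+1)%:R^-1 <= 1 :> R.
  move=> ml; apply: (@le_trans _ _ (\sum_(q < m) l%:R^-1)).
    apply: ler_sum => q _; rewrite /= (leq_trans (ltn_ord q) ml).
    rewrite lef_pV2 ?posrE ?ltr0n //; first by rewrite ler_nat; case: ifP; lia.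
    by case: ifP; lia.
  rewrite sumr_const card_ord -[l%:R^-1 *+ m]mulr_natl ler_pdivrMr ?ltr0n //.
  by rewrite mul1r ler_nat.
case: (leqP n l) => nl'.
  by apply: le_trans (H _ nl') _; rewrite ler1n.
rewrite -(subnKC (ltnW nl')) big_split_ord /= -[(size s).+1]addn1 natrD addrC.
apply: lerD; last exact: H.
under eq_bigr do rewrite ifN -?ltnNge ?ltnS ?leq_addr // -addnS addKn.
apply: IHs => //; lia.
Qed.

Lemma sum_weight_le (f : nat -> nat) n m : (forall i, 0 < f i)%N -> (n <= \sum_(i < m) f i)%N ->
  \sum_(q < n) weight R (InfGaps f) q.+1 <= m%:R.
Proof.
move=> f0 nm; rewrite -sumn_mkseq in nm.
rewrite -[X in _ <= X%:R](size_mkseq f m).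
apply: le_trans (sum_weight_den_le 0 (gaps_prefix_pos m (f0 : gaps_pos (InfGaps f))) nm).
apply: ler_sum => q _; rewrite weightE (@wden_prefix _ _ m) //=.
exact: leq_trans (ltn_ord q) nm.
Qed.

(** Let [d] be the denominator at the position [n].  If the denominators stay
    below [d + q] at [n + q] for all [q] up to [d], then these [d] weights are
    at least [1 / (2 * d)].  If not, a value is skipped at some point, and there
    starts a full block of [l] weights [1 / l]. *)
Lemma weight_block g n : gaps_pos g -> (0 < n)%N ->
  exists m, (n <= m)%N /\ 2^-1 <= \sum_(n <= q < m) weight R g q.+1.
Proof.
move=> g0 n0; pose d := wden g n; have d0 : (0 < d)%N by exact: wden_gt0.
have [H|] := pselect (forall q, (q <= d)%N -> (wden g (n + q) <= d + q)%N).
  exists (n + d)%N; split; first exact: leq_addr.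
  rewrite -{1}[n]add0n big_addn addKn big_mkord.
  apply: (@le_trans _ _ (\sum_(q < d) (d + d)%:R^-1)).
    have d0' : 0 < d%:R :> R by rewrite ltr0n.
    rewrite sumr_const card_ord -[_ *+ d]mulr_natl natrD ler_pdivlMr ?addr_gt0 //.
    lra.
  apply: ler_sum => q _; rewrite weightE -addSn addnC.
  rewrite lef_pV2 ?posrE ?ltr0n ?addn_gt0 ?d0 //; last by apply: wden_gt0 => //; lia.
  rewrite ler_nat; apply: leq_trans (H _ _) _; have := ltn_ord q; lia.
move=> H; have {}H : exists q, (q <= d)%N && (d + q < wden g (n + q))%N.
  apply: contrapT => h; apply: H => q qd; rewrite leqNgt; apply/negP => h'.
  by apply: h; exists q; rewrite qd.
have [[|q] /andP[qd qw] qmin] := ex_minnP H; first by rewrite !addn0 ltnn in qw.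
have qw' : (wden g (n + q) <= d + q)%N.
  rewrite leqNgt; apply/negP => h; have := qmin q; rewrite h (ltnW qd) => /(_ isT).
  by rewrite ltnn.
rewrite !addnS in qw; pose l := wden g (n + q).+1.
exists (n + q + l)%N; split; first by lia.
rewrite (@big_cat_nat _ _ _ (n + q)) //=; [|lia|lia].
apply: (@le_trans _ _ (\sum_(n + q <= i < n + q + l) l%:R^-1)); last first.
  rewrite -[X in X <= _]add0r; apply: lerD.
    by apply: sumr_ge0 => *; exact: weight_ge0.
  apply: ler_sum_nat => i /andP[h1 h2]; rewrite weightE.
  have -> : (i.+1 = n + q + (i.+1 - (n + q)))%N by lia.
  rewrite wden_jump // ?lexx // -?/l; lia.
rewrite sumr_const_nat addKn -[_ *+ l]mulr_natl divff; first by lra.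
by rewrite pnatr_eq0 -lt0n; lia.
Qed.

Lemma sum_weight_dvg g (M : R) : gaps_pos g ->
  exists N, forall n, (N <= n)%N -> M <= \sum_(q < n) weight R g q.+1.
Proof.
move=> g0; suff [N hN] : exists N, M <= \sum_(0 <= q < N) weight R g q.+1.
  exists N => n Nn; rewrite -(big_mkord xpredT (fun q => weight R g q.+1)).
  rewrite (@big_cat_nat _ _ _ N) //=; apply: le_trans hN _.
  by rewrite lerDl; apply: sumr_ge0 => *; exact: weight_ge0.
have H k : exists2 N, (0 < N)%N & k%:R / 2 <= \sum_(0 <= q < N) weight R g q.+1.
  elim: k => [|k [N N0 hN]].
    by exists 1%N => //; rewrite mul0r; apply: sumr_ge0 => *; exact: weight_ge0.
  have [m [Nm hm]] := weight_block g0 N0.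
  exists m; first by lia.
  by rewrite (@big_cat_nat _ _ _ N) //= -natr1; lra.
have [N _ hN] := H (Num.bound `|2 * M|); exists N; apply: le_trans hN.
have := archi_boundP (normr_ge0 (2 * M)); have := ler_norm (2 * M); lra.
Qed.

End Weights.

Local Open Scope ring_scope.

(** * Sums weighted by position *)

Section WeightedSum.
Variables (R : realType) (T : Type).
Implicit Types (W : nat -> T -> R) (f : T -> R) (l : seq T).

Fixpoint wsum W f (K : nat) l : R :=
  if l is z :: l' then W K.+1 z * f z + wsum W f K.+1 l' else 0.

Lemma wsum_cat W f K l l' :
  wsum W f K (l ++ l') = wsum W f K l + wsum W f (K + size l) l'.
Proof.
elim: l K => [|z l IHl] K /=; first by rewrite addn0 add0r.
by rewrite IHl addrA addSnnS.
Qed.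

Lemma wsum_nth z0 W f K l :
  wsum W f K l = \sum_(i < size l) W (K + i.+1)%N (nth z0 l i) * f (nth z0 l i).
Proof.
elim: l K => [|z l IHl] K /=; first by rewrite big_ord0.
rewrite big_ord_recl addn1 IHl; congr (_ + _).
by apply: eq_bigr => i _; rewrite addSnnS.
Qed.

Lemma wsum_le_sum W f K l : (forall q z, W q z <= 1) -> (forall z, 0 <= f z) ->
  wsum W f K l <= \sum_(z <- l) f z.
Proof.
move=> W1 f0; elim: l K => [|z l IHl] K /=; first by rewrite big_nil.
by rewrite big_cons lerD // ler_piMl.
Qed.

End WeightedSum.

Lemma wsum_map (R : realType) (T T' : Type) (h : T' -> T)
    (W : nat -> T -> R) (f : T -> R) K (l : seq T') :
  wsum W f K (map h l) = wsum (fun q z => W q (h z)) (f \o h) K l.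
Proof. by elim: l K => //= z l IHl K; rewrite IHl. Qed.

Lemma eq_wsum (R : realType) (T : eqType) (W W' : nat -> T -> R) (f f' : T -> R) K l :
  (forall q, {in l, W q =1 W' q}) -> {in l, f =1 f'} ->
  wsum W f K l = wsum W' f' K l.
Proof.
elim: l K => //= z l IHl K eW ef; rewrite eW ?ef ?mem_head // IHl // => [q|] y yl.
  by apply: eW; rewrite inE yl orbT.
by apply: ef; rewrite inE yl orbT.
Qed.

Lemma ler_wsum (R : realType) (T : eqType) (W W' : nat -> T -> R) (f : T -> R) K l :
  (forall z, 0 <= f z) ->
  (forall z q, z \in l -> (K < q <= K + size l)%N -> f z != 0 -> W q z <= W' q z) ->
  wsum W f K l <= wsum W' f K l.
Proof.
move=> f0; elim: l K => //= z l IHl K h; apply: lerD.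
  have [->|fz] := eqVneq (f z) 0; first by rewrite !mulr0.
  by rewrite ler_wpM2r // h ?mem_head //; lia.
by apply: IHl => y q yl qK; apply: h; [rewrite inE yl orbT|lia].
Qed.

(** Dropping terms moves the remaining ones to earlier positions, where the
    weights are not smaller; the loss is at most the sum of the dropped values. *)
Lemma wsum_filter (R : realType) (T : eqType) (W : nat -> T -> R) (f : T -> R)
    K K' (P : pred T) l :
  (forall q z, W q z <= 1) -> (forall z, 0 <= f z) ->
  (forall z, z \in l -> forall p q, (0 < p <= q)%N -> W q z <= W p z) ->
  (K' <= K)%N ->
  wsum W f K l <= wsum W f K' (seq.filter P l) + \sum_(z <- l | ~~ P z) f z.
Proof.
move=> W1 f0; elim: l K K' => [|z l IHl] K K' Wle KK' /=.
  by rewrite big_nil addr0.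
have {}IHl k k' : (k' <= k)%N -> wsum W f k l <=
    wsum W f k' (seq.filter P l) + \sum_(z <- l | ~~ P z) f z.
  by apply: IHl => y yl; apply: Wle; rewrite inE yl orbT.
rewrite big_cons; case: ifP => Pz /=.
  rewrite -addrA; apply: lerD; last exact: IHl.
  by rewrite ler_wpM2r // Wle ?mem_head //; lia.
by rewrite addrCA; apply: lerD; [rewrite ler_piMl|apply: IHl; lia].
Qed.

(** * Families of disjoint bushes *)

HB.instance Definition _ := gen_eqMixin gaps.

(** A bush is encoded as the list of its pairs [(s_i, t_i)].  The condition that
    [(s_i, t_i]] avoids the trunk only concerns the trunk between [s_i] and
    later [s_j], so all conditions on a bush are conditions on pairs of indices
    and pass to sublists. *)
Definition bush_pair (p q : tree * tree) : bool :=
  tltb p.1 q.1 && `[< forall u, tltb p.1 u -> tleb u p.2 -> ~~ tleb u q.1 >].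

Definition bush_list (l : seq (tree * tree)) : bool :=
  all (fun p => tleb p.1 p.2) l && pairwise bush_pair l.

Definition segment (p : tree * tree) : set tree :=
  [set u | tleb p.1 u /\ tleb u p.2].

Definition bush_list_set (l : seq (tree * tree)) : set tree :=
  [set u | (exists2 p, p \in l & segment p u) \/
           exists p q, [/\ p \in l, q \in l, tleb p.1 u & tleb u q.1]].

Lemma bush_list_filter P l : bush_list l -> bush_list (seq.filter P l).
Proof.
move=> /andP[le pw]; rewrite /bush_list pairwise_filter // andbT.
by apply/allP => p; rewrite mem_filter => /andP[_ /(allP le)].
Qed.

Lemma bush_list_set_filter P l : bush_list_set (seq.filter P l) `<=` bush_list_set l.
Proof.
move=> u [[p]|[p [q []]]]; rewrite mem_filter => /andP[_ pl].
  by move=> pu; left; exists p.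
by rewrite mem_filter => /andP[_ ql] pu uq; right; exists p, q.
Qed.

(** A common node of the two segments would put [q.1] between [p.1] and [p.2],
    although [q.1] lies on the trunk. *)
Lemma segment_disj p q : tleb p.1 p.2 -> tleb q.1 q.2 -> bush_pair p q ->
  segment p `&` segment q = set0.
Proof.
move=> pp qq /andP[pq /asboolP h]; apply/seteqP; split=> // u [[pu up] [qu uq]].
by have := h _ pq (tleb_trans qu up); rewrite tleb_refl.
Qed.

(** The supremum over the branches through a bush is replaced by the choice of
    one branch, of which only the gaps matter for the weights. *)
Definition entry := (seq (tree * tree) * gaps)%type.

Definition entry_ok (e : entry) : Prop :=
  bush_list e.1 /\
  exists b, gaps_of b e.2 /\ forall p, p \in e.1 -> branch_set b p.1.

Definition entry_disj (e e' : entry) : bool :=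
  `[< bush_list_set e.1 `&` bush_list_set e'.1 = set0 >].

Definition family_ok (F : seq entry) : Prop :=
  (forall e, e \in F -> entry_ok e) /\ pairwise entry_disj F.

(** The terms of the sum that defines the norm, in the order of their positions. *)
Definition terms (F : seq entry) : seq ((tree * tree) * gaps) :=
  [seq (p, e.2) | e <- F, p <- e.1].

Lemma termsP (F : seq entry) (z : (tree * tree) * gaps) : reflect (exists2 e, e \in F & z.1 \in e.1 /\ z.2 = e.2) (z \in terms F).
Proof.
apply: (iffP flattenP) => [[_ /mapP[e eF ->] /mapP[p pe ->]]|[e eF [ze e2]]].
  by exists e.
exists [seq (p, e.2) | p <- e.1]; first by apply/mapP; exists e.
by apply/mapP; exists z.1 => //; rewrite -e2; case: z {ze e2}.
Qed.

Lemma terms_cat F F' : terms (F ++ F') = terms F ++ terms F'.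
Proof. by rewrite /terms map_cat flatten_cat. Qed.

Lemma mem_segment_set p l u : p \in l -> segment p u -> bush_list_set l u.
Proof. by move=> pl pu; left; exists p. Qed.

Lemma terms_le F z : family_ok F -> z \in terms F -> tleb z.1.1 z.1.2.
Proof.
by move=> [ok _] /termsP[e eF [ze _]]; have [/andP[/allP/(_ _ ze)]] := ok _ eF.
Qed.

Definition term_disj (z z' : (tree * tree) * gaps) : bool :=
  `[< segment z.1 `&` segment z'.1 = set0 >].

Lemma terms_disj F : family_ok F -> pairwise term_disj (terms F).
Proof.
elim: F => //= e F IHF [ok /= /andP[eF disj]].
rewrite /terms /= -/(terms F) pairwise_cat IHF ?andbT; last first.
  by split=> // e' e'F; apply: ok; rewrite inE e'F orbT.
have [/andP[le pw] _] := ok e (mem_head _ _).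
apply/andP; split.
  apply/allrelP => z z' /mapP[p pe ->] /termsP[e' e'F [ze' _]].
  apply/asboolP/seteqP; split=> // u [/= pu z'u].
  have /asboolP/seteqP[/(_ u) + _] := allP eF _ e'F; apply.
  by split; [exact: mem_segment_set pe pu|exact: mem_segment_set ze' z'u].
rewrite pairwise_map; apply: (sub_in_pairwise (P := mem e.1)) (pw) => [p q pe qe pq|].
  by apply/asboolP; apply: segment_disj pq; apply: (allP le).
exact/allP.
Qed.

Lemma terms_uniq_t F : family_ok F -> uniq [seq z.1.2 | z <- terms F].
Proof.
move=> ok; rewrite uniq_pairwise pairwise_map.
apply: (sub_in_pairwise (P := mem (terms F))) (terms_disj ok) => [z z' zF z'F|]; last exact/allP.
move=> /asboolP/seteqP[h _]; apply/eqP => e; apply: (h z.1.2); split.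
  by split; [exact: (terms_le ok)|exact: tleb_refl].
by rewrite /segment /= e; split; [exact: (terms_le ok)|exact: tleb_refl].
Qed.

Lemma terms_uniq_s F : family_ok F -> uniq [seq z.1.1 | z <- terms F].
Proof.
move=> ok; rewrite uniq_pairwise pairwise_map.
apply: (sub_in_pairwise (P := mem (terms F))) (terms_disj ok) => [z z' zF z'F|]; last exact/allP.
move=> /asboolP/seteqP[h _]; apply/eqP => e; apply: (h z.1.1); split.
  by split; [exact: tleb_refl|exact: (terms_le ok)].
by rewrite /segment /= e; split; [exact: tleb_refl|exact: (terms_le ok)].
Qed.

Lemma terms_gaps F z : family_ok F -> z \in terms F ->
  exists b, gaps_of b z.2 /\ branch_set b z.1.1.
Proof.
move=> [ok _] /termsP[e eF [ze ->]]; have [_ [b [gb be]]] := ok _ eF.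
by exists b; split=> //; exact: be.
Qed.

Lemma bush_list_set_level l u P :
  (forall p, p \in l -> tleb p.1 p.2) ->
  (forall p, p \in l -> tree_level p.2 <= P)%N -> bush_list_set l u ->
  (tree_level u <= P)%N.
Proof.
move=> le lP [[p pl [_ up]]|[p [q [pl ql _ uq]]]].
  exact: leq_trans (tleb_level up) (lP _ pl).
exact: leq_trans (leq_trans (tleb_level uq) (tleb_level (le _ ql))) (lP _ ql).
Qed.

Lemma bush_list_set_level_gt l u P :
  (forall p, p \in l -> P < tree_level p.1)%N -> bush_list_set l u ->
  (P < tree_level u)%N.
Proof.
by move=> lP [[p pl [pu _]]|[p [q [pl ql pu _]]]];
  exact: leq_trans (lP _ pl) (tleb_level pu).
Qed.

Section FamilyValue.
Variable R : realType.
Implicit Types (x : c00 R) (F : seq entry).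

Definition term_weight (q : nat) (z : (tree * tree) * gaps) : R := weight R z.2 q.
Definition term_abs x (z : (tree * tree) * gaps) : R := `|x z.1.2|.

Definition family_value F x : R := wsum term_weight (term_abs x) 0 (terms F).

Lemma term_weight_le F z p q : family_ok F -> z \in terms F -> (0 < p <= q)%N ->
  term_weight q z <= term_weight p z.
Proof.
move=> ok zF pq; have [b [gb _]] := terms_gaps ok zF.
exact: weight_le (gaps_of_pos gb) pq.
Qed.

Lemma c00_supp x : exists2 s : seq tree, uniq s & forall t, (t \in s) = (x t != 0).
Proof.
have /asboolP/finite_seqP[s e] := c00P x.
exists (undup s); first exact: undup_uniq.
move=> t; rewrite mem_undup; apply/idP/idP => h.
  by have : [set t | x t != 0] t by rewrite e.
by have : [set` s] t by rewrite -e.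
Qed.

(** The nodes [t_j] of a family are distinct and the weights are at most [1], so
    the sum of the moduli of all coefficients is a bound.  It makes the
    supremum in the definition of the norm finite. *)
Lemma family_value_bound x : exists B, forall F, family_ok F -> family_value F x <= B.
Proof.
have [s us sx] := c00_supp x; exists (\sum_(t <- s) `|x t|) => F ok.
apply: le_trans (wsum_le_sum _ _ _ _) _ => [q z|z|]; first exact: weight_le1.
  exact: normr_ge0.
rewrite -(big_map (fun z => z.1.2) xpredT (fun t => `|x t|)).
rewrite (bigID (mem s)) /= [X in _ + X]big1 => [|t]; last first.
  by rewrite sx negbK => /eqP ->; rewrite normr0.
rewrite addr0 [leRHS](bigID (mem [seq z.1.2 | z <- terms F])) /=.
rewrite -big_filter -[X in _ <= X + _]big_filter.
rewrite (perm_big [seq i <- s | i \in [seq z.1.2 | z <- terms F]]) /=.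
  by rewrite lerDl; apply: sumr_ge0.
apply: uniq_perm; rewrite ?filter_uniq ?(terms_uniq_t ok) // => t.
by rewrite !mem_filter andbC.
Qed.

End FamilyValue.

(** * The norm as a supremum over families *)

Section TreeNorm.
Variable R : realType.
Implicit Types (x : c00 R) (F : seq entry) (S : bush).

Let twsum x := wsum (@term_weight R) (term_abs x).

Lemma list_of_bush S : exists l : seq (tree * tree),
  [/\ bush_list l, size l = bush_card S, bush_list_set l `<=` bush_set S,
      (forall b, branch_set b (bush_s S ord_max) ->
         forall p, p \in l -> branch_set b p.1)
    & forall K g x, twsum x K [seq (p, g) | p <- l] =
        \sum_(j < bush_card S) weight R g (K + j.+1)%N * `|x (bush_t S j)|].
Proof.
pose h (j : 'I_(bush_pred S).+1) := (bush_s S j, bush_t S j).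
pose l := [seq h j | j <- enum 'I_(bush_pred S).+1].
have lP p : p \in l -> exists j, p = h j by move=> /mapP[j _ ->]; exists j.
have s_le (i j : 'I_(bush_pred S).+1) : (i <= j)%N -> tleb (bush_s S i) (bush_s S j).
  rewrite leq_eqVlt => /orP[/eqP/val_inj ->|/bush_chain/tltP/tltb_le //].
  exact: tleb_refl.
exists l; split.
- apply/andP; split; first by apply/allP => p /lP[j ->]; apply/tleP; exact: bush_le.
  rewrite pairwise_map.
  have : pairwise (fun i j : 'I_(bush_pred S).+1 => (i < j)%N) (enum 'I_(bush_pred S).+1).
    rewrite -(pairwise_map val ltn) val_enum_ord -(sorted_pairwise ltn_trans).
    exact: iota_ltn_sorted.
  apply: sub_pairwise => i j ij; rewrite /bush_pair /=.
  rewrite (tltP _ _).1; last exact: bush_chain.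
  apply/asboolP => u su ut; apply/negP => usj.
  have st : tlt (bush_s S i) (bush_t S i).
    apply/tltP; rewrite /tltb (tleb_trans (tltb_le su) ut) /=.
    exact: leq_trans (tltb_level su) (tleb_level ut).
  have /seteqP[/(_ u) + _] := bush_trunk st; apply; split.
    by split; [apply/tltP|apply/tleP].
  split; apply/tleP.
    by apply: tleb_trans (tltb_le su); exact: s_le.
  by apply: tleb_trans usj _; apply: s_le; rewrite -ltnS ltn_ord.
- by rewrite size_map size_enum_ord.
- move=> u [[p /lP[j ->] [/= su ut]]|[p [q [/lP[i ->] /lP[j ->] /= pu uq]]]].
    by right; exists j => //; split; apply/tleP.
  left; split; apply/tleP; first by apply: tleb_trans pu; exact: s_le.
  by apply: tleb_trans uq _; apply: s_le; rewrite -ltnS ltn_ord.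
- move=> b bS p /lP[j ->]; apply: branch_set_le bS; apply: s_le.
  by rewrite -ltnS ltn_ord.
- move=> K g x; rewrite -map_comp /twsum wsum_map (wsum_nth ord0) size_enum_ord.
  by apply: eq_bigr => j _; rewrite nth_ord_enum.
Qed.

Definition bush_values (k : nat) S x : set R :=
  [set r | exists b g, [/\ gaps_of b g, branch_set b (bush_s S ord_max) &
    r = \sum_(j < bush_card S) weight R g (k + j.+1)%N * `|x (bush_t S j)|]].

Lemma bush_normE k S x : bush_norm k S x = sup (bush_values k S x).
Proof. by []. Qed.

Lemma bush_values_has_sup k S x : has_sup (bush_values k S x).
Proof.
split.
  have [b bS] := branch_exists (bush_s S ord_max); have [g gb] := gaps_exist b.
  by eexists; exists b, g; split; [exact: gb|exact: bS|reflexivity].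
exists (\sum_(j < bush_card S) `|x (bush_t S j)|) => _ [b [g [_ _ ->]]].
by apply: ler_sum => j _; rewrite ler_piMl // weight_le1.
Qed.

Lemma bush_norm_ge b g k S x : gaps_of b g -> branch_set b (bush_s S ord_max) ->
  \sum_(j < bush_card S) weight R g (k + j.+1)%N * `|x (bush_t S j)| <= bush_norm k S x.
Proof.
move=> gb bS; rewrite bush_normE; apply: ub_le_sup; last by exists b, g.
by have [] := bush_values_has_sup k S x.
Qed.

Lemma bush_of_list (l : seq (tree * tree)) : bush_list l -> l != [::] ->
  exists S, [/\ bush_card S = size l, bush_set S `<=` bush_list_set l &
    forall b g K x, gaps_of b g -> (forall p, p \in l -> branch_set b p.1) ->
      twsum x K [seq (p, g) | p <- l] <= bush_norm K S x].
Proof.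
case: l => // p0 l' /andP[/allP le /(pairwiseP p0) pw] _.
set l := p0 :: l' in le pw *.
pose s (i : 'I_(size l').+1) := (nth p0 l i).1.
pose t (i : 'I_(size l').+1) := (nth p0 l i).2.
have lt_l (i : 'I_(size l').+1) : (i < size l)%N by exact: ltn_ord.
have st i : tleb (s i) (t i) by apply: le; exact: mem_nth.
have bp (i j : 'I_(size l').+1) : (i < j)%N -> bush_pair (nth p0 l i) (nth p0 l j).
  by move=> ij; apply: pw; rewrite ?inE.
have disj (i j : 'I_(size l').+1) : i != j ->
    segment (nth p0 l i) `&` segment (nth p0 l j) = set0.
  rewrite neq_ltn => /orP[ij|ji]; first exact: segment_disj (st i) (st j) (bp _ _ ij).
  by rewrite setIC; exact: segment_disj (st j) (st i) (bp _ _ ji).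
have ch (i j : 'I_(size l').+1) : (i < j)%N -> tlt (s i) (s j).
  by move=> /bp/andP[? _]; apply/tltP.
have tsegE p : tseg p.1 p.2 = segment p.
  by apply/seteqP; split=> u [/tleP ? /tleP ?]; split=> //; exact/tleP.
have trunk i : tlt (s i) (t i) -> [set u | tlt (s i) u /\ tle u (t i)]
    `&` tseg (s ord0) (s ord_max) = set0.
  move=> _; apply/seteqP; split=> // u [[/tltP su /tleP ut] [_ /tleP um]].
  have [im|mi] := ltnP i (@ord_max (size l')).
    by have /andP[_ /asboolP/(_ u su ut)] := bp _ _ im; rewrite um.
  have ei : i = ord_max by apply/val_inj/eqP; rewrite eqn_leq mi -ltnS ltn_ord.
  by have := tltb_level su; rewrite ltnNge ei (tleb_level um).
pose S := @Bush (size l') s t ch (fun i => (tleP _ _).2 (st i))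
  (fun i j ij => etrans (congr2 setI (tsegE _) (tsegE _)) (disj i j ij)) trunk.
exists S; split=> //.
- move=> u [[/tleP su /tleP us]|[i _ [/tleP su /tleP us]]].
    right; exists (nth p0 l (@ord0 (size l'))), (nth p0 l (@ord_max (size l'))).
    by split=> //; exact: mem_nth.
  by left; exists (nth p0 l i); first exact: mem_nth.
- move=> b g K x gb bl.
  apply: le_trans (@bush_norm_ge b g K S x gb _); last by apply: bl; exact: mem_nth.
  rewrite /twsum wsum_map (wsum_nth p0) le_eqVlt; apply/orP; left; apply/eqP.
  by apply: eq_bigr.
Qed.

Lemma size_terms_take F (m : nat) : (m <= size F)%N ->
  size (terms (take m F)) = (\sum_(j < m) size (nth ([::], FinGaps [::]) F j).1)%N.
Proof.
elim: m => [|m IHm] mF; first by rewrite take0 big_ord0.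
rewrite (take_nth ([::], FinGaps [::])) // -cats1 terms_cat size_cat IHm ?(ltnW mF) //.
by rewrite big_ord_recr /= /terms /= cats0 size_map.
Qed.

Lemma family_valueE F x : family_value F x =
  \sum_(i < size F) twsum x (\sum_(j < i) size (nth ([::], FinGaps [::]) F j).1)%N
    [seq (p, (nth ([::], FinGaps [::]) F i).2) | p <- (nth ([::], FinGaps [::]) F i).1].
Proof.
suff H m : (m <= size F)%N -> family_value (take m F) x =
    \sum_(i < m) twsum x (\sum_(j < i) size (nth ([::], FinGaps [::]) F j).1)%N
    [seq (p, (nth ([::], FinGaps [::]) F i).2) | p <- (nth ([::], FinGaps [::]) F i).1].
  by rewrite -{1}[F]take_size H.
elim: m => [|m IHm] mF; first by rewrite take0 big_ord0.
rewrite big_ord_recr -IHm ?(ltnW mF) // (take_nth ([::], FinGaps [::])) // -cats1.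
by rewrite /family_value terms_cat wsum_cat size_terms_take ?(ltnW mF) // /terms /= cats0.
Qed.

Definition tree_norm_values x : set R :=
  [set r | exists n (S : 'I_n.+1 -> bush),
    (forall i j, i != j -> bush_set (S i) `&` bush_set (S j) = set0) /\
    r = \sum_(i < n.+1) bush_norm (\sum_(j < n.+1 | j < i) bush_card (S j))%N (S i) x].

Lemma tree_normE x :
  tree_norm x = Num.max (sup (range (fun t => `|x t|))) (sup (tree_norm_values x)).
Proof. by []. Qed.

(** The supremum over the branches need not be attained for each bush, so the
    error [eps] is distributed evenly over the bushes. *)
Lemma family_of_bushes x r eps : 0 < eps -> tree_norm_values x r ->
  exists2 F, family_ok F & r <= family_value F x + eps.
Proof.
move=> eps0 [n [S [disj ->]]].
pose d := eps / n.+1%:R; have d0 : 0 < d by rewrite divr_gt0.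
pose K (i : 'I_n.+1) := (\sum_(j < n.+1 | j < i) bush_card (S j))%N.
have /choice[h hP] : forall i : 'I_n.+1, exists e : entry,
    [/\ entry_ok e, size e.1 = bush_card (S i), bush_list_set e.1 `<=` bush_set (S i)
      & bush_norm (K i) (S i) x <= twsum x (K i) [seq (p, e.2) | p <- e.1] + d].
  move=> i; have [l [ll sl ls lb lv]] := list_of_bush (S i).
  have [_ [b [g [gb bS ->]]] vd] := sup_adherent d0 (bush_values_has_sup (K i) (S i) x).
  exists (l, g); split=> //=; first by split=> //; exists b; split=> //; exact: lb bS.
  by rewrite lv -lerBlDr ltW.
pose F := [seq h i | i <- enum 'I_n.+1].
have sF : size F = n.+1 by rewrite size_map size_enum_ord.
have nF (i : 'I_n.+1) : nth ([::], FinGaps [::]) F i = h i.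
  by rewrite (nth_map ord0) ?size_enum_ord // nth_ord_enum.
exists F.
  split; first by move=> e /mapP[i _ ->]; have [] := hP i.
  rewrite pairwise_map; apply: (@sub_pairwise _ (fun i j => i != j)).
    move=> i j ij; apply/asboolP/seteqP; split=> // u [ui uj].
    have /seteqP[/(_ u) + _] := disj _ _ ij; apply; split.
      by have [_ _ + _] := hP i; apply.
    by have [_ _ + _] := hP j; apply.
  by rewrite -uniq_pairwise enum_uniq.
rewrite family_valueE sF.
have -> : eps = \sum_(i < n.+1) d.
  by rewrite sumr_const card_ord -[_ *+ _]mulr_natr divfK.
rewrite -big_split /=; apply: ler_sum => i _; rewrite nF.
have [_ _ _] := hP i; congr (_ <= _ + _); congr (twsum x _ _).
rewrite (big_ord_widen n.+1 (fun j => size (nth ([::], FinGaps [::]) F j).1)) ?(ltnW (ltn_ord i)) //.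
by apply: eq_bigr => j _; rewrite nF; have [_ ->] := hP j.
Qed.

Lemma tree_norm_values_ub x : has_ubound (tree_norm_values x).
Proof.
have [B hB] := family_value_bound x; exists (B + 1) => r /(family_of_bushes ltr01)[F ok rF].
by apply: le_trans rF _; rewrite lerD2r; exact: hB.
Qed.

Lemma abs_ub x : has_ubound (range (fun t => `|x t|)).
Proof.
have [s _ sx] := c00_supp x; exists (\sum_(t <- s) `|x t|) => _ [t _ <-].
have [ts|] := boolP (t \in s); last by rewrite sx negbK => /eqP ->; rewrite normr0 sumr_ge0.
by rewrite (big_rem t) //= lerDl sumr_ge0.
Qed.

Lemma abs_le_tree_norm x t : `|x t| <= tree_norm x.
Proof. by rewrite tree_normE le_max ub_le_sup //; exact: abs_ub. Qed.

Lemma tree_norm_ge0 x : 0 <= tree_norm x.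
Proof. exact: le_trans (normr_ge0 _) (abs_le_tree_norm x tree_root). Qed.

(** Removing the empty lists does not change the terms of a family, and
    nonempty lists are bushes. *)
Lemma family_value_le_tree_norm F x : family_ok F -> family_value F x <= tree_norm x.
Proof.
move=> [ok pw].
have [F' [ok' pw' ne eF]] : exists F', [/\ forall e, e \in F' -> entry_ok e,
   pairwise entry_disj F', all (fun e => e.1 != [::]) F' & terms F' = terms F].
  exists (seq.filter (fun e => e.1 != [::]) F); split.
  - by move=> e; rewrite mem_filter => /andP[_]; exact: ok.
  - by rewrite pairwise_filter.
  - exact: filter_all.
  - by elim: (F) => //= -[[|p l] g] F1 IHF //=; rewrite /terms /= -/(terms _) IHF.
have -> : family_value F x = family_value F' x by rewrite /family_value eF.
case: F' => [|e0 F'] in ok' pw' ne {eF} *; first exact: tree_norm_ge0.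
set F1 := e0 :: F' in ok' pw' ne *; set n := size F'.
have lt_n (i : 'I_n.+1) : (i < size F1)%N by exact: ltn_ord.
pose e (i : 'I_n.+1) := nth ([::], FinGaps [::]) F1 i.
have eF1 i : e i \in F1 by exact: mem_nth.
have /choice[S hS] : forall i : 'I_n.+1, exists S, [/\ bush_card S = size (e i).1,
    bush_set S `<=` bush_list_set (e i).1 & forall K,
      twsum x K [seq (p, (e i).2) | p <- (e i).1] <= bush_norm K S x].
  move=> i; have [bl [b [gb be]]] := ok' _ (eF1 i).
  have [S [cS sS vS]] := bush_of_list bl (allP ne _ (eF1 i)).
  by exists S; split=> // K; exact: vS be.
rewrite tree_normE le_max; apply/orP; right.
apply: (@le_trans _ _ (\sum_(i < n.+1) bush_norm
    (\sum_(j < n.+1 | j < i) bush_card (S j))%N (S i) x)); last first.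
  apply: ub_le_sup; first exact: tree_norm_values_ub.
  exists n, S; split=> // i j ij; apply/seteqP; split=> // u [ui uj].
  have [_ /(_ _ ui) {}ui _] := hS i; have [_ /(_ _ uj) {}uj _] := hS j.
  suff /asboolP/seteqP[/(_ u) + _] : entry_disj (e i) (e j) by apply.
  have dij (k k' : 'I_n.+1) : (k < k')%N -> entry_disj (e k) (e k').
    by move/(pairwiseP ([::], FinGaps [::])): pw' => pw'; move=> kk'; apply: pw'; rewrite ?inE.
  move: ij; rewrite neq_ltn => /orP[/dij //|/dij].
  by rewrite /entry_disj setIC.
rewrite family_valueE; apply: ler_sum => i _.
have [_ _ hi] := hS i; apply: le_trans (hi _) _.
rewrite (big_ord_widen n.+1 (fun j => size (nth ([::], FinGaps [::]) F1 j).1)) ?(ltnW (ltn_ord i)) //.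
rewrite le_eqVlt; apply/orP; left; apply/eqP; congr (bush_norm _ _ _).
by apply: eq_bigr => j _; have [-> _ _] := hS j.
Qed.

(** Together with [family_value_le_tree_norm], this replaces the definition of
    the norm by families in all that follows. *)
Lemma tree_norm_le x c : (forall t, `|x t| <= c) ->
  (forall F, family_ok F -> family_value F x <= c) -> tree_norm x <= c.
Proof.
move=> hx hF; rewrite tree_normE ge_max; apply/andP; split.
  apply: ge_sup; first by exists `|x tree_root|, tree_root.
  by move=> _ [t _ <-].
have c0 : 0 <= c by exact: le_trans (normr_ge0 _) (hx tree_root).
have [[r0 r0x]|ne] := pselect (tree_norm_values x !=set0); last first.
  by rewrite sup_out // => -[].
apply: ge_sup; first by exists r0.
move=> r rx; apply/ler_addgt0Pr => eps eps0.
have [F ok rF] := family_of_bushes eps0 rx.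
by apply: le_trans rF _; rewrite lerD2r; exact: hF.
Qed.

Lemma ler_tree_norm x (y : c00 R) : (forall t, `|x t| <= `|y t|) -> tree_norm x <= tree_norm y.
Proof.
move=> xy; apply: tree_norm_le => [t|F ok].
  exact: le_trans (xy t) (abs_le_tree_norm y t).
apply: le_trans (family_value_le_tree_norm y ok).
rewrite /family_value; elim: (terms F) 0%N => //= z l IHl K.
by apply: lerD => //; rewrite ler_wpM2l ?weight_ge0 //; exact: xy.
Qed.

End TreeNorm.

(** * Combinations of unit vectors *)

Section Combinations.
Variable R : realType.

Lemma c00_sumE (I : Type) (r : seq I) (P : pred I) (F : I -> c00 R) t :
  (\sum_(i <- r | P i) F i) t = \sum_(i <- r | P i) F i t.
Proof. exact: (big_morph (fun x : c00 R => x t)). Qed.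

Lemma combE n (a : 'I_n -> R) (al : 'I_n -> tree) t :
  (\sum_(i < n) a i *: unit_vec R (al i)) t = \sum_(i < n) a i * (t == al i)%:R.
Proof. by rewrite c00_sumE. Qed.

Lemma comb_node n (a : 'I_n -> R) (al : 'I_n -> tree) j : injective al ->
  (\sum_(i < n) a i *: unit_vec R (al i)) (al j) = a j.
Proof.
move=> ali; rewrite combE (bigD1 j) //= eqxx mulr1 big1 ?addr0 // => i ij.
by rewrite (inj_eq ali) eq_sym (negPf ij) mulr0.
Qed.

Lemma comb_notin n (a : 'I_n -> R) (al : 'I_n -> tree) t :
  (forall i, t != al i) -> (\sum_(i < n) a i *: unit_vec R (al i)) t = 0.
Proof. by move=> h; rewrite combE big1 // => i _; rewrite (negPf (h i)) mulr0. Qed.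

End Combinations.

Lemma pairwise_mem (T : eqType) (r : rel T) (l : seq T) x y :
  symmetric r -> pairwise r l -> x \in l -> y \in l -> x != y -> r x y.
Proof.
move=> rs /(pairwiseP x) h xl yl xy.
have ix : (index x l < size l)%N by rewrite index_mem.
have iy : (index y l < size l)%N by rewrite index_mem.
case: (ltngtP (index x l) (index y l)) => [ij|ji|e].
- by have := h _ _ ix iy ij; rewrite !nth_index.
- by have := h _ _ iy ix ji; rewrite !nth_index // rs.
- by move: xy; rewrite -(nth_index x xl) e nth_index // eqxx.
Qed.

(** * Nodes far out on a branch *)

Section BranchNodes.
Variables (R : realType) (b : branch) (f : nat -> nat).
Hypothesis gb : gaps_of b (InfGaps f).
Let g := InfGaps f.

Lemma le_sum_gaps n : (n <= \sum_(i < n) f i)%N.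
Proof.
have f0 : forall i, (0 < f i)%N by case: gb.
rewrite -[X in (X <= _)%N]card_ord -sum1_card; apply: leq_sum => i _; exact: f0.
Qed.

(** The largest weight at a position over all branches is attained, because
    weights are inverses of natural numbers. *)
Lemma max_weight_exists (q : nat) : exists g', (exists b', gaps_of b' g') /\
  ((0 < q)%N -> forall b' g'', gaps_of b' g'' -> weight R g'' q <= weight R g' q).
Proof.
have : exists d, `[< exists b' g', gaps_of b' g' /\ wden g' q = d >].
  by exists (wden g q); apply/asboolP; exists b, g.
move=> /ex_minnP[d /asboolP[b' [g' [gb' <-]]] dmin]; exists g'; split; first by exists b'.
move=> q0 b'' g'' gb''; rewrite !weightE.
have ? := wden_gt0 (gaps_of_pos gb') q0; have ? := wden_gt0 (gaps_of_pos gb'') q0.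
rewrite lef_pV2 ?posrE ?ltr0n // ler_nat; apply: dmin.
by apply/asboolP; exists b'', g''.
Qed.

Definition max_gaps : nat -> gaps := projT1 (choice max_weight_exists).

Lemma max_gapsP q : exists b', gaps_of b' (max_gaps q).
Proof. by rewrite /max_gaps; case: choice => G h /=; have [] := h q. Qed.

Lemma weight_le_max b' g' q : (0 < q)%N -> gaps_of b' g' ->
  weight R g' q <= weight R (max_gaps q) q.
Proof. by rewrite /max_gaps; case: choice => G h q0 /=; have [_ hq] := h q; exact: hq. Qed.

Section Configurations.
Variables (n : nat) (lv : 'I_n -> nat).
Hypothesis lv_homo : {homo lv : i j / (i < j)%N}.
Hypothesis lv_ge : forall i, (\sum_(j < n) f j <= lv i)%N.
Variable a : 'I_n -> R.

Let al i := bnode b (lv i).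
Let x := \sum_(i < n) a i *: unit_vec R (al i).

Lemma node_inj : injective al.
Proof.
move=> i j /(congr1 tree_level); rewrite !bnode_level => e.
by case: (ltngtP i j) => [/lv_homo|/lv_homo|/val_inj //]; rewrite e ltnn.
Qed.

(** A configuration lists the nodes that contribute to the value of a family, in
    the order of their positions.  The bush of the node [i0] may start near the
    root, where every branch passes, so that this node gets the largest weight
    over all branches; the others get the weights of the branch [b]. *)
Definition config_gaps (i0 : option 'I_n) (q : nat) (i : 'I_n) : gaps :=
  if Some i == i0 then max_gaps q else g.

Definition config_value (i0 : option 'I_n) (r : seq 'I_n) : R :=
  wsum (fun q i => weight R (config_gaps i0 q i) q) (fun i => `|a i|) 0 r.

Definition config_ok (i0 : option 'I_n) (r : seq 'I_n) : Prop :=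
  uniq r /\ forall i i', i0 = Some i -> i' \in r -> (i <= i')%N.

Lemma weight_config_gaps i0 q i : (0 < q)%N ->
  weight R g q <= weight R (config_gaps i0 q i) q.
Proof.
by move=> q0; rewrite /config_gaps; case: ifP => // _; exact: weight_le_max gb.
Qed.

(** If the segment that ends at a node [al i] starts below level
    [f 0 + ... + f n.-1], it contains all the earlier nodes, so by disjointness
    it is the only such segment and only later nodes occur in other terms.  Any
    other term starts on [b] beyond the first [n] gaps, which forces its weights
    to be those of [b]. *)
Lemma family_value_le_config F : family_ok F ->
  exists i0 r, config_ok i0 r /\ family_value F x <= config_value i0 r.
Proof.
move=> ok.
pose idx (z : (tree * tree) * gaps) : option 'I_n := [pick i | al i == z.1.2].
have idxP z i : idx z = Some i -> z.1.2 = al i.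
  by rewrite /idx; case: pickP => // j /eqP <- [<-].
have idx_comp z z' i i' : z \in terms F -> z' \in terms F ->
    idx z = Some i -> idx z' = Some i' ->
    (tree_level z.1.1 < \sum_(j < n) f j)%N -> (i <= i')%N.
  move=> zF z'F /idxP zi /idxP z'i' lz; rewrite leqNgt; apply/negP => i'i.
  have zz' : z != z'.
    apply: contraTneq i'i => zz'; rewrite zz' z'i' in zi.
    by rewrite (node_inj zi) ltnn.
  have sym : symmetric term_disj by move=> u v; rewrite /term_disj setIC.
  have /asboolP/seteqP[/(_ (al i')) h _] :=
    pairwise_mem sym (terms_disj ok) zF z'F zz'.
  apply: h; split; last first.
    by split; rewrite -z'i'; [exact: terms_le z'F|exact: tleb_refl].
  have i'z : tleb (al i') z.1.2 by rewrite zi; apply: bnode_le; exact/ltnW/lv_homo.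
  split=> //; apply: tleb_chain (terms_le ok zF) i'z _.
  by rewrite bnode_level; apply: leq_trans (ltnW lz) (lv_ge i').
pose rel z : bool := idx z.
pose l := seq.filter rel (terms F).
pose r := pmap idx (terms F).
have er : map Some r = map idx l by rewrite /r /l pmapS_filter.
have rP i : i \in r -> exists2 z, z \in terms F & idx z = Some i.
  move=> /(map_f Some); rewrite er => /mapP[z zl ez]; exists z => //.
  by move: zl; rewrite mem_filter => /andP[].
have ur : uniq r.
  apply: (@map_uniq _ _ al).
  have -> : map al r = map (fun z => z.1.2) l.
    have -> : map al r = map (oapp al tree_root) (map Some r) by rewrite -map_comp.
    rewrite er -map_comp; apply/eq_in_map => z; rewrite mem_filter /rel /= => /andP[+ _].
    by case ez: (idx z) => [i|] //= _; rewrite (idxP _ _ ez).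
  apply: subseq_uniq (terms_uniq_t ok).
  by apply: map_subseq; exact: filter_subseq.
have sr : (size r <= n)%N.
  by have := uniq_leq_size ur (fun i _ => mem_enum 'I_n i); rewrite size_enum_ord.
have [i0 [i0ok hi0]] : exists i0,
    (forall i, i0 = Some i -> exists z, [/\ z \in terms F, idx z = Some i &
                               (tree_level z.1.1 < \sum_(j < n) f j)%N]) /\
    forall z i, z \in terms F -> idx z = Some i ->
       (tree_level z.1.1 < \sum_(j < n) f j)%N -> i0 = Some i.
  have [[z [i [zF zi zl]]]|none] := pselect (exists z i, [/\ z \in terms F,
      idx z = Some i & (tree_level z.1.1 < \sum_(j < n) f j)%N]).
    exists (Some i); split=> [_ [<-]|z' i' z'F z'i' z'l]; first by exists z.
    congr Some; apply/val_inj/eqP; rewrite eqn_leq.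
    by rewrite (idx_comp z z' i i') // (idx_comp z' z i' i).
  by exists None; split=> // z i zF zi zl; case: none; exists z, i.
exists i0, r; split.
  split=> // i i' /i0ok[z [zF zi zl]] /rP[z' z'F z'i'].
  exact: (idx_comp z z' i i').
have x0 z : ~~ rel z -> term_abs x z = 0.
  rewrite /rel /idx /term_abs; case: pickP => // h _.
  by rewrite comb_notin ?normr0 // => i; rewrite eq_sym h.
apply: (@le_trans _ _ (wsum (@term_weight R) (term_abs x) 0 l)).
  have s0 : \sum_(z <- terms F | ~~ rel z) term_abs x z = 0 by exact: big1.
  rewrite -[leRHS]addr0 -[X in _ + X]s0.
  apply: wsum_filter => // [q z|z|z zF p q]; first exact: weight_le1.
    exact: normr_ge0.
  exact: term_weight_le ok zF.
pose W q (o : option 'I_n) := oapp (fun i => weight R (config_gaps i0 q i) q) 0 o.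
pose A (o : option 'I_n) := oapp (fun i => `|a i|) 0 o.
have -> : config_value i0 r = wsum (fun q z => W q (idx z)) (A \o idx) 0 l.
  by rewrite -wsum_map -er wsum_map.
have lF z : z \in l -> z \in terms F by rewrite mem_filter => /andP[].
rewrite (@eq_wsum _ _ _ (@term_weight R) _ (A \o idx)) // => [|z]; last first.
  rewrite mem_filter /rel => /andP[+ _]; rewrite /term_abs /=.
  case ez: (idx z) => [i|] //= _.
  by rewrite (idxP _ _ ez) /x (comb_node _ _ node_inj).
apply: ler_wsum => [z|z q zl ql _]; first by rewrite /= /A; case: (idx z) => /=.
have zF := lF _ zl; move: zl; rewrite mem_filter /rel => /andP[+ _].
have {}ql : (0 < q <= n)%N.
  by rewrite -(size_map idx) -er size_map in ql; lia.
have q0 := (andP ql).1; have [b' [gb' b'z]] := terms_gaps ok zF.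
case ez: (idx z) => [i|] //= _.
have [zl|zl] := ltnP (tree_level z.1.1) (\sum_(j < n) f j)%N.
  by rewrite /W /= /config_gaps (hi0 z i) // eqxx; exact: weight_le_max gb'.
apply: le_trans (weight_config_gaps i0 i q0).
have bz : branch_set b z.1.1.
  by apply: branch_set_le (terms_le ok zF) _; rewrite (idxP _ _ ez).
have /bnode_eqP bb' : bnode b (tree_level z.1.1) = bnode b' (tree_level z.1.1).
  by rewrite -!branch_setE.
rewrite /term_weight (weight_agree R gb gb' bb' (m := n)) //=; first by rewrite size_mkseq.
  by rewrite sumn_mkseq.
by rewrite sumn_mkseq q0 /=; apply: leq_trans (le_sum_gaps n); case/andP: ql.
Qed.

(** The family consists of one-element bushes [(al i, al i)], except for the
    bush [(tree_root, al i0)]; the latter is disjoint from the others because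
    only nodes after [i0] occur. *)
Lemma config_le_tree_norm i0 r : config_ok i0 r -> config_value i0 r <= tree_norm x.
Proof.
move=> [ur hr].
pose s i := if Some i == i0 then tree_root else al i.
pose G i := config_gaps i0 (index i r).+1 i.
pose F : seq entry := [seq ([:: (s i, al i)], G i) | i <- r].
have sal i : tleb (s i) (al i) by rewrite /s; case: ifP => _; rewrite ?tleb_root ?tleb_refl.
have setE i : bush_list_set [:: (s i, al i)] `<=` segment (s i, al i).
  move=> u [[p]|[p [q []]]]; rewrite inE => /eqP -> //=.
  rewrite inE => /eqP -> su us; split=> //; exact: tleb_trans us (sal i).
have okF : family_ok F.
  split.
    move=> _ /mapP[i _ ->]; split; first by rewrite /bush_list /= sal.
    rewrite /= /G /s /config_gaps; case: ifP => _; last first.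
      by exists b; split=> // p; rewrite inE => /eqP ->.
    have [b' gb'] := max_gapsP (index i r).+1.
    by exists b'; split=> // p; rewrite inE => /eqP ->.
  rewrite pairwise_map; move: (ur); rewrite uniq_pairwise.
  apply: (sub_in_pairwise (P := mem r)); last exact/allP.
  have H i j u : i \in r -> j \in r -> i != j -> segment (s i, al i) u ->
      segment (s j, al j) u -> Some j != i0 -> False.
    move=> ir jr ij [/= iu ui] [ju uj] ji0.
    rewrite /= /s (negPf ji0) in ju uj.
    have eu : u = al j.
      by apply/esym/tleb_eq => //; apply/eqP; rewrite eqn_leq !tleb_level.
    rewrite eu {eu u ju uj} in iu ui; move: iu; rewrite /s; case: ifP => [/eqP ei|_] iu.
      have := tleb_level ui; rewrite !bnode_level leqNgt lv_homo //.
      by rewrite ltn_neqAle hr // andbT.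
    have /node_inj/eqP : al i = al j.
      by apply: tleb_eq => //; apply/eqP; rewrite eqn_leq !tleb_level.
    by rewrite (negPf ij).
  move=> i j ir jr /= ij; apply/asboolP/seteqP; split=> // u [/setE ui /setE uj].
  have [ei|ni] := eqVneq (Some i) i0; last by apply: (H j i u) => //; rewrite eq_sym.
  by apply: (H i j u) => //; rewrite -ei; apply: contra_neq ij => -[->].
apply: le_trans (family_value_le_tree_norm x okF).
have eF : terms F = [seq ((s i, al i), G i) | i <- r].
  by rewrite /F; elim: (r) => //= i r' <-.
rewrite /family_value eF wsum_map /config_value.
have [e|i1] : (r = [::]) + 'I_n by case: (r) => [|i r']; [left|right].
  by rewrite e.
rewrite !(wsum_nth i1) le_eqVlt; apply/orP; left; apply/eqP; apply: eq_bigr => k _.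
rewrite /term_weight /term_abs /= /G index_uniq // add0n.
by rewrite /x (comb_node _ _ node_inj).
Qed.

(** Since the coefficients have modulus at most [1], the node [i0] contributes at
    most [1], and the others at most the sum of the first [n] weights of [b],
    which is bounded by the number of gaps that cover [n] positions. *)
Lemma config_value_le i0 r m : config_ok i0 r -> (forall i, `|a i| <= 1) ->
  (n <= \sum_(i < m) f i)%N -> config_value i0 r <= m.+1%:R.
Proof.
move=> [ur _] a1 nm.
have H K : wsum (fun q i => weight R (config_gaps i0 q i) q) (fun i => `|a i|) K r <=
    \sum_(q < size r) weight R g (K + q).+1 + (count (fun i => Some i == i0) r)%:R.
  elim: r {ur} K => [|i r IHr] K; first by rewrite big_ord0 addr0.
  rewrite /= big_ord_recl /= natrD addrACA addn0; apply: lerD; last first.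
    apply: le_trans (IHr K.+1) _; rewrite lerD2r.
    by apply: ler_sum => q _; rewrite /bump /= add1n addnS.
  rewrite /config_gaps; case: ifP => _ /=.
    rewrite -[leLHS]add0r; apply: lerD; first exact: weight_ge0.
    by rewrite mulr_ile1 ?weight_ge0 ?weight_le1.
  by rewrite addr0 ler_piMr ?weight_ge0.
apply: le_trans (H 0%N) _; rewrite -[m.+1]addn1 natrD; apply: lerD; last first.
  rewrite ler_nat; case: i0 {H} => [i|]; last by rewrite (eq_count (a2 := pred0)) ?count_pred0.
  rewrite (eq_count (a2 := pred1 i)) //.
  by rewrite count_uniq_mem // leq_b1.
have sr : (size r <= n)%N.
  by have := uniq_leq_size ur (fun i _ => mem_enum 'I_n i); rewrite size_enum_ord.
under eq_bigr do rewrite add0n.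
by apply: sum_weight_le; [case: gb|exact: leq_trans sr nm].
Qed.

End Configurations.

(** The norm is a maximum over configurations, and these involve the
    coefficients but not the levels of the nodes. *)
Lemma tree_norm_spread n (lv lv' : 'I_n -> nat) (a : 'I_n -> R) :
  {homo lv : i j / (i < j)%N} -> (forall i, (\sum_(j < n) f j <= lv i)%N) ->
  {homo lv' : i j / (i < j)%N} -> (forall i, (\sum_(j < n) f j <= lv' i)%N) ->
  tree_norm (\sum_(i < n) a i *: unit_vec R (bnode b (lv i))) =
  tree_norm (\sum_(i < n) a i *: unit_vec R (bnode b (lv' i))).
Proof.
move: lv lv'; suff H (lv lv' : 'I_n -> nat) :
    {homo lv : i j / (i < j)%N} -> (forall i, (\sum_(j < n) f j <= lv i)%N) ->
    {homo lv' : i j / (i < j)%N} -> (forall i, (\sum_(j < n) f j <= lv' i)%N) ->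
    tree_norm (\sum_(i < n) a i *: unit_vec R (bnode b (lv i))) <=
    tree_norm (\sum_(i < n) a i *: unit_vec R (bnode b (lv' i))).
  by move=> lv lv' h1 h2 h3 h4; apply/eqP; rewrite eq_le !H.
move=> h1 h2 h3 h4; apply: tree_norm_le => [t|F ok].
  have [[i ->]|h] := pselect (exists i, t = bnode b (lv i)).
    rewrite (comb_node _ _ (node_inj h1)) -(comb_node a _ (node_inj h3)).
    exact: abs_le_tree_norm.
  rewrite comb_notin ?normr0 ?tree_norm_ge0 // => i; apply/eqP => ti.
  by apply: h; exists i.
have [i0 [r [rok /le_trans]]] := family_value_le_config h1 h2 a ok; apply.
exact: config_le_tree_norm.
Qed.

Lemma tree_norm_sum_le n m (lv : 'I_n -> nat) (a : 'I_n -> R) :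
  {homo lv : i j / (i < j)%N} -> (forall i, (\sum_(j < n) f j <= lv i)%N) ->
  (forall i, `|a i| <= 1) -> (n <= \sum_(i < m) f i)%N ->
  tree_norm (\sum_(i < n) a i *: unit_vec R (bnode b (lv i))) <= m.+1%:R.
Proof.
move=> h1 h2 a1 nm; apply: tree_norm_le => [t|F ok].
  apply: (@le_trans _ _ 1); last by rewrite ler1n.
  have [[i ->]|h] := pselect (exists i, t = bnode b (lv i)).
    by rewrite (comb_node _ _ (node_inj h1)).
  rewrite comb_notin ?normr0 ?ler01 // => i; apply/eqP => ti.
  by apply: h; exists i.
have [i0 [r [rok /le_trans]]] := family_value_le_config h1 h2 a ok; apply.
exact: config_value_le rok a1 nm.
Qed.

End BranchNodes.

(** * Bounded sequences *)

Section BoundedSequences.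
Variables (R : realType) (Y : completeNormedModType R).

Definition bounded_seqs : {pred nat -> Y} :=
  [pred u : nat -> Y | `[< exists M : R, forall n, `|u n| <= M >]].

Lemma bounded_seqs_submod_closed : submod_closed bounded_seqs.
Proof.
split; first by apply/asboolP; exists 0 => n; rewrite normr0.
move=> a u v /asboolP[M uM] /asboolP[N vN]; apply/asboolP; exists (`|a| * M + N) => n.
rewrite -[X in `|X|]/(a *: u n + v n); apply: le_trans (ler_normD _ _) _.
by rewrite normrZ lerD // ler_wpM2l.
Qed.

HB.instance Definition _ :=
  GRing.isSubmodClosed.Build R (nat -> Y) bounded_seqs bounded_seqs_submod_closed.

Record linfty := Linfty { linfty_val :> nat -> Y; linftyP : linfty_val \in bounded_seqs }.
HB.instance Definition _ := [isSub for linfty_val].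
HB.instance Definition _ := [Choice of linfty by <:].
HB.instance Definition _ := [SubChoice_isSubLmodule of linfty by <:].

Implicit Types u v : linfty.

Definition linfty_norm u : R := sup (range (fun n => `|u n|)).

Lemma linfty_norm_ge u n : `|u n| <= linfty_norm u.
Proof.
apply: ub_le_sup; last by exists n.
by have /asboolP[M uM] := linftyP u; exists M => _ [k _ <-].
Qed.

Lemma linfty_norm_le u M : (forall n, `|u n| <= M) -> linfty_norm u <= M.
Proof. by move=> uM; apply: ge_sup => [|_ [n _ <-]]; [exists `|u 0|, 0|exact: uM]. Qed.

Lemma linfty_normD u v : linfty_norm (u + v) <= linfty_norm u + linfty_norm v.
Proof.
apply: linfty_norm_le => n; apply: le_trans (ler_normD _ _) _.
by apply: lerD; exact: linfty_norm_ge.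
Qed.

Lemma linfty_normZ (a : R) u : linfty_norm (a *: u) = `|a| * linfty_norm u.
Proof.
have H (c : R) (w : linfty) : linfty_norm (c *: w) <= `|c| * linfty_norm w.
  apply: linfty_norm_le => n; rewrite -[X in `|X|]/(c *: w n) normrZ.
  by rewrite ler_wpM2l // linfty_norm_ge.
have [->|a0] := eqVneq a 0.
  apply/eqP; rewrite eq_le H /= normr0 mul0r.
  exact: le_trans (normr_ge0 _) (linfty_norm_ge _ 0).
apply/eqP; rewrite eq_le H /=; have := H a^-1 (a *: u).
by rewrite scalerA mulVf // scale1r normfV ler_pdivlMl ?normr_gt0.
Qed.

Lemma linfty_norm0_eq0 u : linfty_norm u = 0 -> u = 0.
Proof.
move=> u0; apply/val_inj/funext => n; apply/eqP.
by rewrite -normr_le0 -u0; exact: linfty_norm_ge.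
Qed.

HB.instance Definition _ :=
  Lmodule_isNormed.Build R linfty linfty_normD linfty_normZ linfty_norm0_eq0.

Lemma linfty_normE u : `|u| = linfty_norm u. Proof. by []. Qed.

(** The limit is taken coordinatewise; if [x] is within [e] of almost all [u],
    then it is within [e] of the limit in every coordinate. *)
Lemma linfty_complete (F : set_system linfty) : ProperFilter F -> cauchy F -> cvg F.
Proof.
move=> FF /cauchyP Fc.
have near_pt (x : linfty) (e : R) n : F (ball x e) ->
    F [set u | `|x n - u n| < e].
  apply: filterS => u; rewrite -ball_normE /= => xu.
  by apply: le_lt_trans xu; exact: (linfty_norm_ge (x - u) n).
have /choice[l lP] (n : nat) : exists ln : Y, (fun u : linfty => u n) @ F --> ln.
  have PF := fmap_proper_filter (fun u : linfty => u n) FF.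
  apply/cvg_ex; apply: cauchy_cvg; apply: cauchy_exP => e e0.
  have [x Fx] := Fc e e0; exists (x n); rewrite /nbhs /=.
  have := near_pt _ _ n Fx; apply: filterS => u /=.
  by rewrite -ball_normE.
have lx (x : linfty) e n : 0 < e -> F (ball x e) -> `|l n - x n| <= e.
  move=> e0 Fx; apply/ler_addgt0Pr => d d0.
  have /cvgrPdist_lt/(_ d d0) Fl := lP n.
  have [u [lu xu]] := filter_ex (filterI Fl (near_pt _ _ n Fx)).
  rewrite -(subrKA (u n)) addrC [e + d]addrC; apply: le_trans (ler_normD _ _) _.
  by rewrite addrC [`|u n - _|]distrC; apply: lerD; exact: ltW.
have lb : l \in bounded_seqs.
  have [x Fx] := Fc 1 ltr01; apply/asboolP; exists (1 + linfty_norm x) => n.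
  rewrite -[l n](subrK (x n)); apply: le_trans (ler_normD _ _) _.
  by apply: lerD; [exact: lx|exact: linfty_norm_ge].
apply/cvg_ex; exists (Linfty lb); apply/fcvgrPdist_lt => e e0.
have e2 : 0 < e / 2 by rewrite divr_gt0.
have [x Fx] := Fc _ e2; rewrite /prop_near1; move: (Fx); apply: filterS => u.
rewrite -ball_normE /= => xu.
rewrite -(subrKA x) [e]splitr; apply: le_lt_trans (ler_normD _ _) _.
apply: ler_ltD => //; rewrite linfty_normE; apply: linfty_norm_le => n.
exact: lx.
Qed.

HB.instance Definition _ := Uniform_isComplete.Build linfty linfty_complete.

Definition linfty_space : completeNormedModType R := linfty.

Lemma linfty_sumE (I : Type) (r : seq I) (P : pred I) (F : I -> linfty) n :
  (\sum_(i <- r | P i) F i) n = \sum_(i <- r | P i) F i n.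
Proof. exact: (big_morph (fun u : linfty => u n)). Qed.

End BoundedSequences.

(** * Monotone basic sequences *)

Section MonotoneBasis.
Variables (R : realType) (E : completeNormedModType R) (x : nat -> E).
Hypothesis x_neq0 : forall i, x i != 0.
Let comb (a : nat -> R) m := \sum_(i < m) a i *: x i.
Hypothesis comb_mono : forall a m n, (m <= n)%N -> `|comb a m| <= `|comb a n|.

Let combB a a' m : comb a m - comb a' m = comb (fun i => a i - a' i) m.
Proof. by rewrite -sumrB; apply: eq_bigr => i _; rewrite scalerBl. Qed.

Let coef_le a i n : (i < n)%N -> `|a i| <= 2 / `|x i| * `|comb a n|.
Proof.
move=> lin; rewrite mulrAC ler_pdivlMr ?normr_gt0 // -normrZ.
have -> : a i *: x i = comb a i.+1 - comb a i by rewrite /comb big_ord_recr /= [X in X - _]addrC addrK.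
apply: le_trans (ler_normB _ _) _.
have := comb_mono a lin; have := comb_mono a (ltnW lin); lra.
Qed.

Let seriesE a m : series (fun i => a i *: x i) m = comb a m.
Proof. by rewrite seriesEord. Qed.

(** Monotonicity bounds the coefficients and all partial sums by the norm.  So
    the coefficients of finite combinations that converge to [y] converge, and
    the partial sums of the limit series are uniformly close to those of the
    approximations, which are eventually constant. *)
Lemma monotone_basic_sequence : basic_sequence x.
Proof.
move=> y y_cl.
have approx (k : nat) : exists na : nat * (nat -> R),
    (forall m, (na.1 <= m)%N -> comb na.2 m = comb na.2 na.1) /\
    `|y - comb na.2 na.1| < k.+1%:R^-1.
  have k0 : 0 < k.+1%:R^-1 :> R by rewrite invr_gt0.
  have [_ [[n [a ->]]]] := y_cl _ (nbhsx_ballx y _ k0).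
  rewrite -ball_normE /= => ya.
  pose a' i := if (i < n)%N then a i else 0.
  have e : \sum_(i < n) a i *: x i = comb a' n.
    by apply: eq_bigr => i _; rewrite /a' ltn_ord.
  exists (n, a') => /=; split; last by rewrite -e.
  move=> m nm; rewrite /comb -[in LHS](subnKC nm) big_split_ord /= -[RHS]addr0; congr (_ + _).
  by apply: big1 => i _; rewrite /a' ltnNge leq_addr scale0r.
(* [na k] is the length and the coefficient sequence of the [k]-th approximation. *)
have {approx} /choice[na naP] := approx.
pose A k := (na k).2; pose d k : R := k.+1%:R^-1.
have AB k l m : `|comb (A k) m - comb (A l) m| <= d k + d l.
  have [N [mN kN lN]] : exists N, [/\ m <= N, (na k).1 <= N & (na l).1 <= N]%N.
    exists (m + (na k).1 + (na l).1)%N; split; lia.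
  rewrite combB; apply: le_trans (comb_mono _ mN) _; rewrite -combB.
  have [-> // hk] := naP k; have [-> // hl] := naP l.
  rewrite -(subrKA y) addrC; apply: le_trans (ler_normD _ _) _.
  by rewrite addrC; apply: lerD; apply: ltW; rewrite // distrC.
have d_cvg : d @ \oo --> 0 by exact: cvg_harmonic.
have /choice[a aP] (i : nat) : exists ai : R, (fun k => A k i) @ \oo --> ai.
  apply/cvg_ex; apply: cauchy_cvg; apply: cauchy_exP => e e0.
  pose c : R := 2 / `|x i|; have c0 : 0 < c by rewrite divr_gt0 ?normr_gt0.
  have e1 : 0 < e / (2 * c) / 2 by rewrite !divr_gt0 // mulr_gt0.
  have [K _ hK] := (cvgr0Pnorm_lt _).1 d_cvg _ e1.
  exists (A K i); rewrite /nbhs /=; exists K => // l /= Kl.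
  rewrite -ball_normE /=; apply: le_lt_trans (_ : c * (d K + d l) < e).
    have := @coef_le (fun i => A K i - A l i) i i.+1 (ltnSn i).
    move=> /le_trans; apply; rewrite -combB ler_wpM2l //; exact: ltW.
  have := hK K (leqnn K); have := hK l Kl.
  have d0 k : 0 < d k by rewrite invr_gt0.
  rewrite /= !gtr0_norm // => h1 h2.
  have ee : e = c * (e / (2 * c) / 2 + e / (2 * c) / 2) + e / 2 by field; lra.
  have : c * (d K + d l) < c * (e / (2 * c) / 2 + e / (2 * c) / 2).
    by rewrite ltr_pM2l // ltrD.
  lra.
have cvc m : (fun l => comb (A l) m) @ \oo --> comb a m.
  elim: m => [|m IHm].
    by under eq_fun do rewrite /comb big_ord0; rewrite /comb big_ord0; exact: cvg_cst.
  under eq_fun do rewrite /comb big_ord_recr /=; rewrite /comb big_ord_recr /=.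
  by apply: cvgD IHm _; apply: cvgZr_tmp; exact: aP.
have Aa k m : `|comb (A k) m - comb a m| <= 2 * d k.
  have cv : (fun l => comb (A k) m - comb (A l) m) @ \oo --> comb (A k) m - comb a m.
    by apply: cvgB (cvg_cst _) _; exact: cvc.
  have cvn : (fun l => `|comb (A k) m - comb (A l) m|) @ \oo --> `|comb (A k) m - comb a m|.
    exact: cvg_norm.
  rewrite -(cvg_lim _ cvn) //.
  apply: limr_le; first by apply/cvg_ex; eexists; exact: cvn.
  exists k => // l /= kl; apply: le_trans (AB _ _ _) _.
  by rewrite mulr2n mulrDl mul1r lerD2l lef_pV2 ?posrE ?ltr0n // ler_nat.
have cva : series (fun i => a i *: x i) @ \oo --> y.
  apply/cvgrPdist_lt => e e0; have e4 : 0 < e / 4 by rewrite divr_gt0.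
  have [K _ /(_ K (leqnn K)) hK] := (cvgr0Pnorm_lt _).1 d_cvg _ e4.
  have [tail hy] := naP K.
  exists (na K).1 => // m /= hm; rewrite seriesE.
  rewrite -(subrKA (comb (A K) m)); apply: le_lt_trans (ler_normD _ _) _.
  rewrite {1}[comb _ m]tail //; have := Aa K m; move: hK.
  rewrite /= gtr0_norm ?invr_gt0 // -/(d K); move: hy; rewrite -/(d K) -/(A K); lra.
exists a; split=> // a' cva'; apply/funext => i; apply/eqP; rewrite -subr_eq0.
rewrite -normr_le0; apply/ler_addgt0Pr => e e0; rewrite add0r.
pose c : R := 2 / `|x i|; have c0 : 0 < c by rewrite divr_gt0 ?normr_gt0.
have cv0 : (fun m => comb (fun i => a i - a' i) m) @ \oo --> (0 : E).
  rewrite -(subrr y); under eq_fun do rewrite -combB -!seriesE.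
  exact: cvgB.
have ec : 0 < e / c by rewrite divr_gt0.
have [K _ hK] := (cvgr0Pnorm_lt _).1 cv0 _ ec.
have /= h := hK (maxn K i.+1) (leq_maxl _ _).
apply: le_trans (@coef_le (fun i => a i - a' i) i (maxn K i.+1) _) _; first exact: leq_maxr.
by rewrite -/c -ler_pdivlMl // mulrC ltW.
Qed.

End MonotoneBasis.

(** * Sequences that are their own spreading model *)

Section ExactSpreading.
Variables (R : realType) (Y : completeNormedModType R) (x : nat -> Y).
Hypothesis x1 : forall i, `|x i| = 1.
Hypothesis spread : forall n (a : 'I_n -> R) (k k' : 'I_n -> nat),
  {homo k : i j / (i < j)%N} -> (forall i, (n <= (k i).+1)%N) ->
  {homo k' : i j / (i < j)%N} -> (forall i, (n <= (k' i).+1)%N) ->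
  `|\sum_(i < n) a i *: x (k i)| = `|\sum_(i < n) a i *: x (k' i)|.
Hypothesis mono : forall n (a : 'I_n -> R) (k : 'I_n -> nat) (P : pred 'I_n),
  {homo k : i j / (i < j)%N} ->
  `|\sum_(i < n | P i) a i *: x (k i)| <= `|\sum_(i < n) a i *: x (k i)|.

Let shift_homo n p : {homo (fun i : 'I_n => p + i)%N : i j / (i < j)%N}.
Proof. by move=> i j; rewrite ltn_add2l. Qed.

Let spread_shift n p q (a : 'I_n -> R) : (n <= p)%N -> (n <= q)%N ->
  `|\sum_(j < n) a j *: x (p + j)| = `|\sum_(j < n) a j *: x (q + j)|.
Proof.
by move=> np nq; apply: spread; try exact: shift_homo; move=> i; lia.
Qed.

(** The spreading model is built from truncated shifts of [x]: the [n]-th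
    coordinates of the first [n] vectors are [x n, ..., x (2 * n - 1)], far
    enough for [spread] to apply, and the truncation removes the combinations
    that are too long for their position.  By [spread] and [mono] the coordinates
    from [m] on all give the norm of a combination of length [m]. *)
Lemma spread_seq_bounded (j : nat) :
  (fun n => if (j < n)%N then x (n + j) else 0) \in @bounded_seqs R Y.
Proof. by apply/asboolP; exists 1 => n; case: ifP; rewrite ?x1 ?normr0. Qed.

Definition spread_seq j : linfty_space Y := Linfty (spread_seq_bounded j).

Lemma norm_spread_seq m (a : 'I_m -> R) :
  `|\sum_(j < m) a j *: spread_seq j| = `|\sum_(j < m) a j *: x (m + j)|.
Proof.
have ev n : (\sum_(j < m) a j *: spread_seq j : linfty Y) n =
    \sum_(j < m | (j < n)%N) a j *: x (n + j).
  rewrite linfty_sumE [RHS]big_mkcond; apply: eq_bigr => j _.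
  by rewrite -[LHS]/(a j *: (if _ then _ else _)); case: ifP => // _; rewrite scaler0.
apply/eqP; rewrite linfty_normE eq_le; apply/andP; split; last first.
  apply: le_trans (linfty_norm_ge _ m); rewrite ev.
  by rewrite [in leRHS](eq_bigl xpredT) // => j; rewrite ltn_ord.
apply: linfty_norm_le => n; rewrite ev.
have [mn|nm] := leqP m n.
  rewrite (eq_bigl xpredT) => [|j]; last by rewrite (leq_trans (ltn_ord j) mn).
  by rewrite (spread_shift a mn (leqnn m)).
rewrite (big_ord_narrow (ltnW nm)) /=.
rewrite (spread_shift (fun j => a (widen_ord (ltnW nm) j)) (leqnn n) (ltnW nm)).
have := mono a (fun j => (j < n)%N) (@shift_homo m m).
by rewrite (big_ord_narrow (ltnW nm)).
Qed.

Lemma spread_seq_spreading_model : has_spreading_model x spread_seq.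
Proof.
split.
- by exists 1, 1; split=> // i; rewrite x1 lexx.
- apply: monotone_basic_sequence => [i|a m n mn].
    have : `|spread_seq i| = 1; last by move=> h; rewrite -normr_gt0 h.
    apply/eqP; rewrite linfty_normE eq_le; apply/andP; split.
      by apply: linfty_norm_le => n /=; case: ifP => _; rewrite ?x1 ?normr0.
    have := linfty_norm_ge (spread_seq i) i.+1; rewrite /= ltnSn x1.
    by [].
  rewrite !norm_spread_seq.
  rewrite (spread_shift (fun i : 'I_m => a i) (leqnn m) mn).
  have := mono (fun j : 'I_n => a j) (fun j => (j < m)%N) (@shift_homo n n).
  by rewrite (big_ord_narrow mn).
- exists (fun n => n.+1%:R^-1); split.
  + apply/nonincreasing_seqP => n; rewrite lef_pV2 ?posrE ?ltr0n //.
    by rewrite ler_nat.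
  + exact: cvg_harmonic.
  + move=> n n0 a _ k kh kn; rewrite norm_spread_seq.
    have -> : `|\sum_(i < n) a i *: x (k i)| = `|\sum_(i < n) a i *: x (n + i)|.
      by apply: spread => //; try exact: shift_homo; move=> i; lia.
    by rewrite subrr normr0 invr_gt0.
Qed.

End ExactSpreading.

(** * Small spreading models *)

Section SmallSpreadingModel.
Variables (R : realType) (Y : completeNormedModType R) (iota : {linear c00 R -> Y}).
Hypothesis iotaE : forall v, `|iota v| = tree_norm v.

Lemma tree_norm_unit t : tree_norm (unit_vec R t) = 1.
Proof.
have ev u : `|unit_vec R t u| = (u == t)%:R by rewrite normr_nat.
apply/eqP; rewrite eq_le; apply/andP; split; last first.
  by have := abs_le_tree_norm (unit_vec R t) t; rewrite ev eqxx.
apply: tree_norm_le => [u|F ok]; first by rewrite ev lern1 leq_b1.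
apply: le_trans (wsum_le_sum _ _ _ _) _ => [q z|z|]; first exact: weight_le1.
  exact: normr_ge0.
under eq_bigr do rewrite /term_abs ev.
rewrite -(big_map (fun z => z.1.2) xpredT (fun u => (u == t)%:R)) -natr_sum lern1.
rewrite (eq_bigr (fun u => if u == t then 1 else 0)%N) => [|u _]; last by case: eqP.
by rewrite -big_mkcond sum1_count (count_uniq_mem t (terms_uniq_t ok)) leq_b1.
Qed.

Variable f : nat -> nat.
Hypothesis f_gt0 : forall i, (0 < f i)%N.

Let sg m := (\sum_(i < m) f i)%N.

Definition gaps_branch (k : nat) : bool := `[< exists2 m, (0 < m)%N & k.+1 = sg m >].

Lemma gaps_branchP : gaps_of gaps_branch (InfGaps f).
Proof. by split=> // k; split=> [/asboolP|?] //; exact/asboolP. Qed.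

Lemma sg_mono m n : (m <= n)%N -> (sg m <= sg n)%N.
Proof. by move=> mn; rewrite /sg -(subnKC mn) big_split_ord leq_addr. Qed.

Lemma sg_lt m n : (m < n)%N -> (sg m < sg n)%N.
Proof.
move=> mn; apply: leq_trans (sg_mono mn).
by rewrite /sg big_ord_recr /= -[X in (X < _)%N]addn0 ltn_add2l.
Qed.

(** The node [gap_node i] ends the gap number [i.+1], so that every branch
    through it has the same weights up to the position [i.+1]. *)
Definition gap_node i := bnode gaps_branch (sg i.+1).

Let x i := iota (unit_vec R (gap_node i)).

Lemma gap_node_norm i : `|x i| = 1.
Proof. by rewrite /x iotaE tree_norm_unit. Qed.

Lemma gap_node_comb n (a : 'I_n -> R) (k : 'I_n -> nat) (P : pred 'I_n) :
  \sum_(i < n | P i) a i *: x (k i) =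
  iota (\sum_(i < n | P i) a i *: unit_vec R (bnode gaps_branch (sg (k i).+1))).
Proof. by rewrite linear_sum; apply: eq_bigr => i _; rewrite linearZ. Qed.

Lemma gap_node_spread n (a : 'I_n -> R) (k k' : 'I_n -> nat) :
  {homo k : i j / (i < j)%N} -> (forall i, (n <= (k i).+1)%N) ->
  {homo k' : i j / (i < j)%N} -> (forall i, (n <= (k' i).+1)%N) ->
  `|\sum_(i < n) a i *: x (k i)| = `|\sum_(i < n) a i *: x (k' i)|.
Proof.
move=> kh kn k'h k'n; rewrite !gap_node_comb !iotaE.
apply: (tree_norm_spread gaps_branchP); first by move=> i j /kh h; apply: sg_lt.
- by move=> i; apply: sg_mono.
- by move=> i j /k'h h; apply: sg_lt.
- by move=> i; apply: sg_mono.
Qed.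

Lemma gap_node_mono n (a : 'I_n -> R) (k : 'I_n -> nat) (P : pred 'I_n) :
  {homo k : i j / (i < j)%N} ->
  `|\sum_(i < n | P i) a i *: x (k i)| <= `|\sum_(i < n) a i *: x (k i)|.
Proof.
move=> kh; rewrite !gap_node_comb !iotaE; apply: ler_tree_norm => t.
have alh : {homo (fun i : 'I_n => sg (k i).+1) : i j / (i < j)%N}.
  by move=> i j /kh h; apply: sg_lt.
have ali := node_inj (b := gaps_branch) alh.
have -> : \sum_(i < n | P i) a i *: unit_vec R (bnode gaps_branch (sg (k i).+1)) =
    \sum_(i < n) (if P i then a i else 0) *: unit_vec R (bnode gaps_branch (sg (k i).+1)).
  by rewrite big_mkcond; apply: eq_bigr => i _; case: ifP => // _; rewrite scale0r.
have [[i ->]|h] := pselect (exists i : 'I_n, t = bnode gaps_branch (sg (k i).+1)).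
  by rewrite !(comb_node _ _ ali); case: ifP => // _; rewrite normr0.
have nt (i : 'I_n) : t != bnode gaps_branch (sg (k i).+1).
  by apply/eqP => ti; apply: h; exists i.
by rewrite !(comb_notin _ nt).
Qed.

Definition gap_model : nat -> linfty_space Y := spread_seq gap_node_norm.

Lemma gap_model_spreading : has_spreading_model x gap_model.
Proof.
exact: (spread_seq_spreading_model gap_node_norm gap_node_spread gap_node_mono).
Qed.

Lemma gap_model_norm_le n m : (n <= sg m)%N -> `|\sum_(i < n) gap_model i| <= m.+1%:R.
Proof.
move=> nm; have -> : \sum_(i < n) gap_model i = \sum_(i < n) (1 : R) *: gap_model i.
  by apply: eq_bigr => i _; rewrite scale1r.
rewrite (norm_spread_seq gap_node_norm gap_node_spread gap_node_mono (fun=> 1)).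
rewrite (gap_node_comb (fun=> 1) (fun i => n + i)%N) iotaE.
apply: (tree_norm_sum_le gaps_branchP _ _ _ nm).
- by move=> i j ij; apply: sg_lt; lia.
- by move=> i; apply: sg_mono; lia.
- by move=> i; rewrite normr1.
Qed.

End SmallSpreadingModel.

(** The gaps [f] are so long that [lambda] is at least [(m + 1) ^ 2] beyond the
    end of the [m]-th gap, while the norm of the [n]-th sum is at most [m + 2]
    if [n] lies in the gap after it. *)
Lemma small_spreading_model (R : realType) (Y : completeNormedModType R)
    (iota : {linear c00 R -> Y}) (iotaE : forall v, `|iota v| = tree_norm v)
    (lambda : nat -> R) : lambda @ \oo --> +oo ->
  exists x : nat -> Y, subsequence_of x (fun n => iota (unit_vec R (lex n))) /\
    exists (E : completeNormedModType R) (xt : nat -> E),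
      has_spreading_model x xt /\
      (fun n => `|\sum_(i < n) xt i| / lambda n) @ \oo --> (0 : R).
Proof.
move=> /cvgryPge lam.
have /choice[T hT] (m : nat) : exists T : nat,
    forall n, (T <= n)%N -> m.+1%:R * m.+1%:R <= lambda n.
  by have [T _ h] := lam (m.+1%:R * m.+1%:R); exists T => n /h.
pose f i := (T i.+1).+1; have f0 i : (0 < f i)%N by [].
pose sg m := (\sum_(i < m) f i)%N.
have sgT m : (T m.+1 <= sg m.+1)%N.
  by rewrite /sg big_ord_recr /=; apply: leq_trans (leqnSn _) (leq_addl _ _).
exists (fun i => iota (unit_vec R (gap_node f i))); split.
  exists (fun i => lex_rank (gap_node f i)); split.
    by move=> i j ij; apply: lex_rank_lt; rewrite !bnode_level; apply: sg_lt.
  by apply/funext => i /=; rewrite lex_rankE.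
exists (linfty_space Y), (gap_model iotaE f); split; first exact: gap_model_spreading.
apply/cvgr0Pnorm_lt => e e0.
pose M := (Num.bound (2 / e)).+1; exists (sg M).+1 => // n /= nM.
have [m nm mmin] : exists2 m, (n <= sg m)%N & forall m', (n <= sg m')%N -> (m <= m')%N.
  have ex : exists m, (n <= sg m)%N.
    by exists n; apply: le_sum_gaps (gaps_branchP f0) n.
  by have [m nm h] := ex_minnP ex; exists m.
have Mm : (M < m)%N.
  rewrite ltnNge; apply/negP => /(sg_mono f) h.
  by have := leq_trans nM (leq_trans nm h); rewrite ltnn.
case: m => [|[|m]] in nm mmin Mm *; [lia|lia|].
have nm1 : (sg m.+1 < n)%N by rewrite ltnNge; apply/negP => /mmin; lia.
have lamn : m.+2%:R * m.+2%:R <= lambda n by apply: hT; apply: leq_trans (sgT m) (ltnW nm1).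
(* The quotient is at most [m.+3 / m.+2 ^ 2], which is below [2 / m.+2]. *)
have m0 : 0 < m.+2%:R :> R by rewrite ltr0n.
have lam0 : 0 < lambda n by apply: lt_le_trans lamn; rewrite mulr_gt0.
rewrite ger0_norm ?divr_ge0 ?(ltW lam0) // ltr_pdivrMr //.
apply: le_lt_trans (gap_model_norm_le iotaE f0 nm) _.
have := archi_boundP (divr_ge0 (ler0n R 2) (ltW e0)); rewrite ltr_pdivrMr // => hb.
have hbm : (Num.bound (2 / e))%:R <= m.+2%:R :> R by rewrite ler_nat; lia.
have : e * (m.+2%:R * m.+2%:R) <= e * lambda n by rewrite ler_pM2l.
apply: lt_le_trans; rewrite mulrA.
have h2 : 2 < e * m.+2%:R.
  by apply: lt_le_trans hb _; rewrite mulrC ler_pM2l.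
apply: (@lt_trans _ _ (2 * m.+2%:R)); last by rewrite ltr_pM2r.
have : 2 <= m.+2%:R :> R by rewrite ler_nat.
rewrite -[m.+3]addn1 natrD; lra.
Qed.

(** * Selecting terms of a family *)

Definition family_filter (P : pred (tree * tree)) (F : seq entry) : seq entry :=
  [seq (seq.filter P e.1, e.2) | e <- F].

Lemma terms_family_filter P F :
  terms (family_filter P F) = seq.filter (fun z => P z.1) (terms F).
Proof.
elim: F => //= e F IHF; rewrite /terms /= -/(terms _) IHF filter_cat -/(terms F).
by rewrite filter_map.
Qed.

Lemma family_filter_ok P F : family_ok F -> family_ok (family_filter P F).
Proof.
move=> [ok pw]; split=> [_ /mapP[e eF ->]|].
  have [bl [b [gb be]]] := ok e eF; split; first exact: bush_list_filter.
  by exists b; split=> // p; rewrite mem_filter => /andP[_ /be].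
rewrite pairwise_map; apply: sub_pairwise pw => e e' /asboolP/seteqP[h _].
apply/asboolP/seteqP; split=> // u [/= eu e'u]; apply: (h u); split.
  exact: bush_list_set_filter eu.
exact: bush_list_set_filter e'u.
Qed.

(** * Long sums of blocks *)

Lemma tchild_subproof (n i : nat) (d : bool) : (i < 2 ^ n -> i.*2 + d < 2 ^ n.+1)%N.
Proof. by rewrite expnS; case: d; lia. Qed.

Definition tchild (s : tree) (d : bool) : tree :=
  tree_node (tree_level s).+1 (Ordinal (tchild_subproof d (tree_index_lt s))).

Lemma bnodeS b n : bnode b n.+1 = tchild (bnode b n) (b n).
Proof. exact: tree_eq. Qed.

Lemma tchild_le s t : tltb s t -> exists d, tleb (tchild s d) t.
Proof.
move=> st; have [b bt] := branch_exists t.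
have bs := branch_set_le (tltb_le st) bt.
exists (b (tree_level s)); rewrite (branch_setE bs) -bnodeS (branch_setE bt).
by apply: bnode_le; exact: tltb_level.
Qed.

Section Blocks.
Variables (R : realType) (u : nat -> c00 R) (p : nat -> nat).
Hypothesis p_homo : {homo p : i j / (i < j)%N}.
Hypothesis u_supp : forall i t, u i t != 0 -> (p i <= lex_rank t < p i.+1)%N.
Hypothesis u_norm : forall i, tree_norm (u i) = 1.

Let p_ge i : (i <= p i)%N.
Proof. by elim: i => // i IHi; exact: leq_ltn_trans IHi (p_homo (ltnSn i)). Qed.

Let u_disj i j t : u i t != 0 -> u j t != 0 -> i = j.
Proof.
have p_le m n : (m <= n)%N -> (p m <= p n)%N.
  by rewrite leq_eqVlt => /orP[/eqP -> //|/p_homo/ltnW].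
have H m n : (m < n)%N -> u m t != 0 -> u n t != 0 -> False.
  by move=> mn /u_supp h1 /u_supp h2; have := p_le _ _ mn; lia.
move=> it jt; case: (ltngtP i j) => // ij.
  by case: (H _ _ ij it jt).
by case: (H _ _ ij jt it).
Qed.

Let u_supp_level i t P : u i t != 0 -> (2 ^ P.+1 <= i)%N -> (P < tree_level t)%N.
Proof.
move=> /u_supp/andP[pt _] Pi; rewrite ltnNge; apply/negP => /lex_rank_ub tP.
have := p_ge i; lia.
Qed.

Section LargeCoefficients.
Variable delta : R.
Hypothesis delta_gt0 : 0 < delta.
Hypothesis large : forall N, exists i, (N <= i)%N /\ exists t, delta <= `|u i t|.

Let below (s : tree) : Prop := forall N, exists i, (N <= i)%N /\
  exists t, tleb s t /\ delta <= `|u i t|.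

Let below_root : below tree_root.
Proof.
move=> N; have [i [Ni [t ut]]] := large N; exists i; split=> //; exists t.
by rewrite tleb_root.
Qed.

Let below_child s : below s -> below (tchild s false) \/ below (tchild s true).
Proof.
move=> bs; apply: contrapT => /not_orP[/existsNP[N1 h1] /existsNP[N2 h2]].
have [i [Ni [t [st ut]]]] := bs (N1 + N2 + (lex_rank s).+1)%N.
have ut0 : u i t != 0 by rewrite -normr_gt0; exact: lt_le_trans ut.
have [est|/tchild_le[d td]] := tlebNlt st.
  by have := u_supp ut0; have := p_ge i; rewrite -est; lia.
by case: d td => td; [apply: h2|apply: h1]; exists i; split; try lia; exists t.
Qed.

(** A path from the root all of whose nodes satisfy [below], as in Koenig's
    lemma. *)
Let walk : nat -> tree := fix walk n :=
  if n is n'.+1 then tchild (walk n') (~~ `[< below (tchild (walk n') false) >])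
  else tree_root.

Let limit_branch : branch := fun n => ~~ `[< below (tchild (walk n) false) >].

Let walkE n : walk n = bnode limit_branch n.
Proof. by elim: n => [|n IHn]; [exact: tree_eq|rewrite bnodeS -IHn]. Qed.

Let below_limit n : below (bnode limit_branch n).
Proof.
rewrite -walkE; elim: n => [|n IHn] /=; first exact: below_root.
case: asboolP => //= h.
by have [] := below_child IHn.
Qed.

(** [M] is the level at which the path to the node [t] leaves the limit branch. *)
Lemma large_step (mN : nat * nat) : exists itM : nat * tree * nat,
  [/\ (mN.2 <= itM.1.1)%N, (mN.1 <= itM.2)%N, delta <= `|u itM.1.1 itM.1.2|,
      tleb (bnode limit_branch itM.2) itM.1.2 &
      forall M, (itM.2 < M)%N -> ~~ tleb (bnode limit_branch M) itM.1.2].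
Proof.
case: mN => m N; have [i [Ni [t [mt ut]]]] := below_limit m N.
have ex : exists M, tleb (bnode limit_branch M) t by exists m.
have ub M : tleb (bnode limit_branch M) t -> (M <= tree_level t)%N.
  by move/tleb_level.
have [M Mt Mmax] := ex_maxnP ex ub.
exists (i, t, M); split=> //=; first exact: Mmax.
by move=> M' MM'; apply/negP => /Mmax; rewrite leqNgt MM'.
Qed.

(** Large coefficients are chosen at nodes [t j] that leave the limit branch at
    increasing levels [L j].  The pairs [(bnode limit_branch (L j), t j)] form a
    single bush with trunk on the branch, and its value is at least [delta]
    times the sum of the first weights, which is unbounded. *)
Lemma large_blocks (M : R) : exists n0, forall n, (n0 <= n)%N ->
  exists k : 'I_n -> nat, [/\ {homo k : i j / (i < j)%N},
    forall i, (n <= (k i).+1)%N & M <= tree_norm (\sum_(i < n) u (k i))].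
Proof.
have [g gb] := gaps_exist limit_branch.
have [n0 hn0] := @sum_weight_dvg R g (M / delta) (gaps_of_pos gb).
exists n0 => n n0n.
have [step stepP] := choice large_step.
pose z := fix z j := if j is j'.+1 then step ((z j').2.+1, (z j').1.1.+1)
                     else step (0%N, n).
pose k j := (z j).1.1; pose t j := (z j).1.2; pose L j := (z j).2.
have zP j : [/\ delta <= `|u (k j) (t j)|, tleb (bnode limit_branch (L j)) (t j) &
      forall M, (L j < M)%N -> ~~ tleb (bnode limit_branch M) (t j)].
  by case: j => [|j]; rewrite /k /t /L /=; [have [] := stepP (0%N, n)
    | have [] := stepP ((z j).2.+1, (z j).1.1.+1)].
have kS j : (k j < k j.+1)%N by have [] := stepP ((z j).2.+1, (z j).1.1.+1).
have LS j : (L j < L j.+1)%N by have [] := stepP ((z j).2.+1, (z j).1.1.+1).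
have k0 : (n <= k 0)%N by have [] := stepP (0%N, n).
have mono (f : nat -> nat) : (forall j, (f j < f j.+1)%N) ->
    {homo f : i j / (i < j)%N}.
  by move=> fS; apply: homo_ltn => //; exact: ltn_trans.
have kn j : (n <= k j)%N.
  by case: j => // j; apply: leq_trans k0 _; apply: ltnW; exact: mono.
exists (fun j => k j); split; first by move=> i j; exact: mono.
  by move=> i; exact: leq_trans (kn i) (leqnSn _).
set v := \sum_(i < n) _.
have tj0 j : u (k j) (t j) != 0.
  by have [h _ _] := zP j; rewrite -normr_gt0; exact: lt_le_trans h.
have vt (j : 'I_n) : v (t j) = u (k j) (t j).
  rewrite /v c00_sumE (bigD1 j) //= big1 ?addr0 // => i ij; apply/eqP.
  apply: contraNT ij => it; have /eqP := u_disj it (tj0 j).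
  rewrite -val_eqE /=; case: (ltngtP i j) => // /(mono _ kS) h /eqP e.
    by rewrite e ltnn in h.
  by rewrite e ltnn in h.
pose l := [seq (bnode limit_branch (L j), t j) | j <- iota 0 n].
have ok : family_ok [:: (l, g)].
  split=> //= e; rewrite inE => /eqP -> /=; split; last first.
    by exists limit_branch; split=> // q /mapP[j _ ->].
  apply/andP; split; first by apply/allP => q /mapP[j _ ->]; have [] := zP j.
  rewrite pairwise_map.
  have : pairwise ltn (iota 0 n).
    by rewrite -(sorted_pairwise ltn_trans) iota_ltn_sorted.
  apply: sub_pairwise => i j /= ij; have Lij := mono _ LS _ _ ij.
  rewrite /bush_pair /tltb /= bnode_le ?(ltnW Lij) //= Lij.
  apply/asboolP => w iw wt; apply/negP => wj.
  have wb : w = bnode limit_branch (tree_level w).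
    by apply: branch_setE; apply: branch_set_le wj _.
  have [_ _ /(_ (tree_level w))] := zP i; rewrite -wb wt.
  by move=> /(_ (tltb_level iw)).
apply: le_trans (family_value_le_tree_norm v ok).
rewrite /family_value /terms /= cats0 -map_comp wsum_map (wsum_nth 0%N) size_iota.
apply: (@le_trans _ _ (\sum_(i < n) weight R g i.+1 * delta)).
  by rewrite -mulr_suml -ler_pdivrMr //; exact: hn0.
apply: ler_sum => i _; rewrite nth_iota // !add0n /term_weight /term_abs /=.
rewrite ler_wpM2l ?weight_ge0 // vt; by have [] := zP i.
Qed.

End LargeCoefficients.

Let sum_const (T : Type) (l : seq T) (P : pred T) (d : R) :
  \sum_(z <- l | P z) d = (count P l)%:R * d.
Proof. by rewrite big_const_seq iter_addr_0 mulr_natl. Qed.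

Section SmallCoefficients.
Hypothesis small : forall delta : R, 0 < delta ->
  exists N, forall i t, (N <= i)%N -> `|u i t| < delta.

(** In a family that nearly attains the norm [1] of a block, the first [K] terms
    and the terms that start at a level up to [P], of which there are at most
    [2 ^ P.+1], only contribute a tiny amount if the coefficients are tiny.
    Without the latter, the bushes lie beyond level [P], hence are disjoint from
    any bushes up to that level; without the former, the terms can be placed
    after [K] others and keep at least their weights. *)
Lemma small_family K P : exists N, forall i, (N <= i)%N -> exists F,
  [/\ family_ok F,
      forall z, z \in terms F -> u i z.1.2 != 0 /\ (P < tree_level z.1.1)%N &
      1 / 2 <= wsum (@term_weight R) (term_abs (u i)) K (terms F)].
Proof.
(* [c] bounds the number of terms that are given up. *)
pose c : R := K%:R + (2 ^ P.+1)%:R.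
have c1 : 1 <= c.
  have : 1 <= (2 ^ P.+1)%:R :> R by rewrite ler1n expn_gt0.
  have : 0 <= K%:R :> R by [].
  rewrite /c; lra.
pose delta := 1 / 4 / c.
have delta0 : 0 < delta by rewrite !divr_gt0 //; lra.
have [N hN] := small delta0; exists N => i Ni.
have u0 t : `|u i t| <= delta by apply/ltW/hN.
have [F0 [ok0 vF0]] : exists F, family_ok F /\ 3 / 4 < family_value F (u i).
  apply: contrapT => h; suff : tree_norm (u i) <= 3 / 4 by rewrite u_norm; lra.
  apply: tree_norm_le => [t|F ok].
    apply: le_trans (u0 t) _; rewrite /delta ler_pdivrMr; lra.
  by rewrite leNgt; apply/negP => hF; apply: h; exists F.
pose L := terms F0; pose early := [seq z.1.2 | z <- take K L].
pose keep (q : tree * tree) :=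
  [&& u i q.2 != 0, (P < tree_level q.1)%N & q.2 \notin early].
exists (family_filter keep F0); rewrite terms_family_filter; split.
- exact: family_filter_ok.
- by move=> z; rewrite mem_filter => /andP[/and3P[]].
have ts_uniq := terms_uniq_t ok0.
have drop_early z : z \in drop K L -> z.1.2 \notin early.
  move=> zd; move: ts_uniq; rewrite -/L -(cat_take_drop K L) map_cat cat_uniq.
  move=> /and3P[_ /hasPn h _]; apply: h; exact: (map_f (fun z => z.1.2)).
have -> : [seq z <- terms F0 | keep z.1] = [seq z <- drop K L | keep z.1].
  rewrite -/L -{1}(cat_take_drop K L) filter_cat.
  rewrite -[RHS]cat0s; congr (_ ++ _).
  rewrite -(filter_pred0 (take K L)); apply: eq_in_filter => z zt /=.
  by rewrite /keep (map_f (fun z => z.1.2)) // !andbF.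
have wt : wsum (@term_weight R) (term_abs (u i)) 0 (take K L) <= K%:R * delta.
  apply: le_trans (wsum_le_sum _ _ _ _) _ => [q z|z|]; first exact: weight_le1.
    exact: normr_ge0.
  apply: (@le_trans _ _ (\sum_(z <- take K L) delta)).
    by apply: ler_sum => z _; exact: u0.
  rewrite sum_const count_predT ler_wpM2r ?(ltW delta0) //.
  by rewrite ler_nat size_take_min geq_minl.
have wd : wsum (@term_weight R) (term_abs (u i)) (size (take K L)) (drop K L) <=
    wsum (@term_weight R) (term_abs (u i)) K [seq z <- drop K L | keep z.1] +
    \sum_(z <- drop K L | ~~ keep z.1) term_abs (u i) z.
  have [LK|KL] := leqP (size L) K; first by rewrite drop_oversize //= big_nil addr0.
  apply: wsum_filter => [q z|z|z zd q r|]; first exact: weight_le1.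
  - exact: normr_ge0.
  - by apply: term_weight_le ok0 _; exact: mem_drop zd.
  - by rewrite size_takel // ltnW.
have lost : \sum_(z <- drop K L | ~~ keep z.1) term_abs (u i) z <= (2 ^ P.+1)%:R * delta.
  apply: (@le_trans _ _ (\sum_(z <- drop K L | (tree_level z.1.1 <= P)%N) delta)).
    rewrite big_mkcond [leRHS]big_mkcond big_seq [leRHS]big_seq; apply: ler_sum => z zd.
    rewrite /keep drop_early // andbT negb_and negbK -leqNgt.
    have [u0z|_] /= := eqVneq; last by case: ifP => _; rewrite ?u0.
    by rewrite /term_abs u0z normr0; case: ifP => // _; exact: ltW.
  rewrite sum_const ler_wpM2r ?(ltW delta0) // ler_nat.
  rewrite -size_filter -(size_map (fun z => lex_rank z.1.1)) -[leqRHS](size_iota 0).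
  apply: uniq_leq_size.
    rewrite (map_comp lex_rank (fun z => z.1.1)) map_inj_uniq; last exact: lex_rank_inj.
    apply: subseq_uniq (terms_uniq_s ok0); apply: map_subseq.
    by apply: subseq_trans (filter_subseq _ _) (drop_subseq _ _).
  move=> m /mapP[z]; rewrite mem_filter => /andP[zP _] ->.
  by rewrite mem_iota add0n lex_rank_ub.
have cd : (K%:R + (2 ^ P.+1)%:R) * delta = 1 / 4.
  by rewrite /delta mulrC divfK //; lra.
move: vF0; rewrite /family_value -/L -(cat_take_drop K L) wsum_cat add0n.
move: wt wd lost cd; rewrite cat_take_drop; lra.
Qed.

(** The families of the blocks are appended one by one, each block being chosen
    beyond the bound [P] on the levels used so far. *)
Lemma small_blocks_step n N : exists ks : seq nat, exists F, exists P,
  let v := \sum_(i <- ks) u i in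
  [/\ size ks = n, path ltn N ks, family_ok F &
    [/\ (forall z, z \in terms F -> (tree_level z.1.2 <= P)%N),
        (forall t, v t != 0 -> (tree_level t <= P)%N)
      & n%:R / 2 <= family_value F v]].
Proof.
elim: n => [|n [ks [F [P /= [sks pks okF [FP vP vF]]]]]].
  exists [::], [::], 0%N => /=; split=> //; split=> // [t|].
    by rewrite big_nil eqxx.
  by rewrite mul0r.
have [N1 hN1] := small_family (size (terms F)) P.
pose i := ((last N ks).+1 + N1 + 2 ^ P.+1)%N.
have [F1 [okF1 F1P vF1]] := hN1 i ltac:(rewrite /i; lia).
pose P' := maxn P (p i.+1); have PP' : (P <= P')%N by exact: leq_maxl.
exists (rcons ks i), (F ++ F1), P' => /=.
have uiP t : u i t != 0 -> (P < tree_level t <= P')%N.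
  move=> ut; rewrite (@u_supp_level i t P ut) /=; last by rewrite /i; lia.
  have := u_supp ut; have := level_lex_rank t; rewrite /P'; lia.
set v : c00 R := \sum_(j <- ks) u j in vP vF *.
pose v' : c00 R := v + u i; have v'E t : v' t = v t + u i t by [].
have -> : \sum_(j <- rcons ks i) u j = v' by rewrite -cats1 big_cat big_seq1.
have F_ui z : z \in terms F -> u i z.1.2 = 0.
  by move=> /FP zP; apply/eqP; apply: contraTT zP => /uiP/andP[h _]; rewrite -ltnNge.
have F1_v z : z \in terms F1 -> v z.1.2 = 0.
  move=> zF1; have [_ zP] := F1P _ zF1; have := tleb_level (terms_le okF1 zF1) => zl.
  apply/eqP; apply: contraTT (leq_trans zP zl) => /vP; by rewrite -leqNgt.
split; first by rewrite size_rcons sks.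
- by rewrite rcons_path pks /= /i; lia.
- have [okF' pwF] := okF; have [okF1' pwF1] := okF1.
  split=> [e|]; first by rewrite mem_cat => /orP[/okF'|/okF1'].
  rewrite pairwise_cat pwF pwF1 !andbT; apply/allrelP => e e' eF e'F1.
  apply/asboolP/seteqP; split=> // t [et e't].
  have [/andP[/allP le _] _] := okF' _ eF.
  have tP : (tree_level t <= P)%N.
    apply: (bush_list_set_level le _ et) => q qe.
    by apply: (FP (q, e.2)); apply/termsP; exists e.
  have : (P < tree_level t)%N; last by rewrite ltnNge tP.
  apply: (bush_list_set_level_gt _ e't) => q qe.
  by have [] := F1P (q, e'.2) ltac:(apply/termsP; exists e').
split.
- move=> z; rewrite terms_cat mem_cat => /orP[/FP h|/F1P[/uiP/andP[_ h] _]] //.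
  exact: leq_trans h PP'.
- move=> t; rewrite v'E; have [->|/uiP/andP[_ h _] //] := eqVneq (u i t) 0.
  by rewrite addr0 => /vP h; exact: leq_trans h PP'.
- rewrite /family_value terms_cat wsum_cat add0n.
  have -> : wsum (@term_weight R) (term_abs v') 0 (terms F) = family_value F v.
    by apply: eq_wsum => // z zF; rewrite /term_abs v'E F_ui // addr0.
  have -> : wsum (@term_weight R) (term_abs v') (size (terms F)) (terms F1) =
            wsum (@term_weight R) (term_abs (u i)) (size (terms F)) (terms F1).
    by apply: eq_wsum => // z zF; rewrite /term_abs v'E F1_v // add0r.
  by rewrite -natr1; lra.
Qed.

Lemma small_blocks (M : R) : exists n0, forall n, (n0 <= n)%N ->
  exists k : 'I_n -> nat, [/\ {homo k : i j / (i < j)%N},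
    forall i, (n <= (k i).+1)%N & M <= tree_norm (\sum_(i < n) u (k i))].
Proof.
exists (Num.bound `|2 * M|) => n hn.
have [ks [F [P [sks pks okF [_ _ vF]]]]] := small_blocks_step n n.
have srt : sorted ltn ks by exact: path_sorted pks.
exists (fun j => nth 0%N ks j); split.
- move=> i j ij; apply: (sorted_ltn_nth ltn_trans) => //; by rewrite inE sks.
- move=> i; have := order_path_min ltn_trans pks => /allP/(_ (nth 0%N ks i)).
  by rewrite mem_nth ?sks // => /(_ isT) /= /ltnW h; exact: leq_trans h (leqnSn _).
have -> : \sum_(i < n) u (nth 0%N ks i) = \sum_(i <- ks) u i.
  by rewrite (big_nth 0%N) big_mkord sks.
apply: le_trans (family_value_le_tree_norm _ okF); apply: le_trans vF.
have := archi_boundP (normr_ge0 (2 * M)); have := ler_norm (2 * M).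
have : (Num.bound `|2 * M|)%:R <= n%:R :> R by rewrite ler_nat.
lra.
Qed.

End SmallCoefficients.

(** Either infinitely many blocks have a coefficient of modulus at least some
    fixed [delta], or the coefficients tend to [0] uniformly. *)
Lemma long_block_sums (M : R) : exists n0, forall n, (n0 <= n)%N ->
  exists k : 'I_n -> nat, [/\ {homo k : i j / (i < j)%N},
    forall i, (n <= (k i).+1)%N & M <= tree_norm (\sum_(i < n) u (k i))].
Proof.
have [[delta [delta0 h]]|h] := pselect (exists delta : R, 0 < delta /\
    forall N, exists i, (N <= i)%N /\ exists t, delta <= `|u i t|).
  exact: (large_blocks delta0 h).
apply: small_blocks => delta delta0; apply: contrapT => hN; apply: h.
exists delta; split=> // N; apply: contrapT => hi; apply: hN; exists N => i t Ni.
by rewrite ltNge; apply/negP => ut; apply: hi; exists i; split=> //; exists t.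
Qed.

End Blocks.

(** * Spreading models of block bases *)

Lemma block_spreading_model_dvg (R : realType) (Y : completeNormedModType R)
    (iota : {linear c00 R -> Y}) (iotaE : forall v, `|iota v| = tree_norm v)
    (x : nat -> Y) : block_basis (fun n => iota (unit_vec R (lex n))) x ->
  (forall i, `|x i| = 1) ->
  forall (E : completeNormedModType R) (xt : nat -> E),
    has_spreading_model x xt -> (fun n => `|\sum_(i < n) xt i|) @ \oo --> +oo.
Proof.
move=> [p [a [p_homo xE]]] x1 E xt [_ _ [eps [_ eps0 spread]]].
pose u i : c00 R := \sum_(p i <= j < p i.+1) a j *: unit_vec R (lex j).
have xu i : x i = iota (u i).
  have [-> _] := xE i; rewrite linear_sum; apply: eq_bigr => j _.
  by rewrite linearZ.
have u_supp i t : u i t != 0 -> (p i <= lex_rank t < p i.+1)%N.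
  apply: contraNT => out; apply/eqP; rewrite /u c00_sumE big_nat.
  apply: big1 => j jp; rewrite -[LHS]/(a j * (t == lex j)%:R).
  have -> : (t == lex j) = false; last by rewrite mulr0.
  by apply: contraNF out => /eqP ->; rewrite lex_rankK.
have u_norm i : tree_norm (u i) = 1 by rewrite -iotaE -xu.
apply/cvgryPge => A.
have [n0 hn0] := long_block_sums p_homo u_supp u_norm (A + 1).
have [n1 _ hn1] := (cvgr0Pnorm_lt _).1 eps0 1 ltr01.
exists (n0 + n1 + 1)%N => // n /= hn.
have [k [k_homo kn Ak]] := hn0 n ltac:(lia).
have := spread n ltac:(lia) (fun=> 1) _ k k_homo kn.
have /= e1 := hn1 n ltac:(rewrite /=; lia).
under eq_bigr do rewrite scale1r xu.
under [X in _ - `|X|]eq_bigr do rewrite scale1r.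
rewrite -linear_sum iotaE => h.
have {}h : `|tree_norm (\sum_(i < n) u (k i)) - `|\sum_(i < n) xt i| | < eps n.
  by apply: h => i; lra.
have := ler_norm (eps n); have := ler_norm (tree_norm (\sum_(i < n) u (k i)) - `|\sum_(i < n) xt i|).
lra.
Qed.

Theorem proposition3p13 (R : realType) (Y : completeNormedModType R)
    (iota : {linear c00 R -> Y}) (hY : is_completion (@tree_norm R) iota) :
  let e : nat -> Y := fun n => iota (unit_vec R (lex n)) in
  (forall lambda : nat -> R, lambda @ \oo --> +oo ->
    exists x : nat -> Y, subsequence_of x e /\
    exists (E : completeNormedModType R) (xt : nat -> E),
      has_spreading_model x xt /\
      (fun n => `|\sum_(i < n) xt i| / lambda n) @ \oo --> (0 : R)) /\
  (forall x : nat -> Y, block_basis e x -> (forall i, `|x i| = 1) ->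
    forall (E : completeNormedModType R) (xt : nat -> E),
      has_spreading_model x xt ->
      (fun n => `|\sum_(i < n) xt i|) @ \oo --> +oo).
Proof.
have [iotaE _] := hY; split; first exact: small_spreading_model.
exact: block_spreading_model_dvg.
Qed.
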